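(* Let $G$ and $H$ be totally disconnected locally compact groups, let $\mathbb{Q}$ be endowed with the trivial $G$- and $H$-actions, and let $n\in\mathbb{Z}_{\ge0}$. Then there is an isomorphism of $\mathbb{Q}$-vector spaces $$\mathrm{dH}_n(G\times H,\mathbb{Q})\cong\bigoplus_{p=0}^n\mathrm{dH}_p(G,\mathbb{Q})\otimes\mathrm{dH}_{n-p}(H,\mathbb{Q})\ \oplus\ \bigoplus_{p=0}^{n-1}\mathrm{Tor}_1^{\mathbb{Q}}\big(\mathrm{dH}_p(G,\mathbb{Q}),\mathrm{dH}_{n-1-p}(H,\mathbb{Q})\big).$$
   Context: $G\times H$ carries the product topology. For a totally disconnected locally compact group $G$, a discrete $\mathbb{Q}[G]$-module is a left $\mathbb{Q}[G]$-module on which $G$ acts with open point stabilisers; the category of such modules is abelian with enough projectives. Rational discrete homology is $\mathrm{dH}_n(G,M)=\mathrm{H}_n(P_\bullet\otimes_GM)$ for a projective resolution $P_\bullet\to\mathbb{Q}$ of the trivial module in this category (with $P_\bullet$ regarded as right modules via inversion). *)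

(* Defs.v *)
From HB Require Import structures.
From mathcomp Require Import all_boot all_order all_algebra.
From mathcomp Require Import finmap all_classical topology.
From mathcomp Require monalg.
(* The notations of monalg clash with those of the topology library. *)
Import -(notations) monalg.

Set Implicit Arguments.
Unset Strict Implicit.
Unset Printing Implicit Defensive.

Import GRing.Theory.

Local Open Scope classical_set_scope.
Local Open Scope ring_scope.

Section Quotient.
Variables (R : pzRingType) (V : lmodType R) (S : set V).

Definition is_submod (T : set V) : Prop :=
  T 0 /\ forall (a : R) (x y : V), T x -> T y -> T (a *: x + y).

Definition span : {pred V} := [pred x | `[< smallest is_submod S x >]].

Lemma spanP (x : V) :
  reflect (forall T, is_submod T -> S `<=` T -> T x) (x \in span).
Proof.
apply: (iffP (asboolP _)) => [h T sT ST|h T [sT ST]]; last exact: h.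
by apply: (h T); split.
Qed.

Fact span_submod_closed : GRing.submod_closed span.
Proof.
split=> [|a x y /spanP hx /spanP hy]; apply/spanP => T sT ST; first by case: sT.
by case: (sT) => _; apply; [exact: hx|exact: hy].
Qed.
HB.instance Definition _ :=
  GRing.isSubmodClosed.Build R V span span_submod_closed.

Lemma sub_span (x : V) : S x -> x \in span.
Proof. by move=> Sx; apply/spanP => T _; apply. Qed.

Definition quotmod : Type := Quotient.quot span.
HB.instance Definition _ := GRing.Zmodule.on quotmod.

Definition qproj (x : V) : quotmod := (\pi_(Quotient.quot span) x)%qT.
Definition qrepr (x : quotmod) : V := generic_quotient.repr x.

Lemma qprojP (x y : V) : reflect (qproj x = qproj y) (x - y \in span).
Proof. by rewrite Quotient.idealrBE; exact: eqP. Qed.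

Lemma qreprK : cancel qrepr qproj.
Proof. exact: generic_quotient.reprK. Qed.

Lemma qprojD : {morph qproj : x y / x + y}.
Proof. by move=> x y; rewrite /qproj raddfD. Qed.

Definition qscale (a : R) (x : quotmod) : quotmod := qproj (a *: qrepr x).

Lemma qprojZ (a : R) (x : V) : qproj (a *: x) = qscale a (qproj x).
Proof.
apply/qprojP; rewrite -scalerBr rpredZ//; apply/qprojP.
by rewrite qreprK.
Qed.

Fact qscaleA (a b : R) (x : quotmod) :
  qscale a (qscale b x) = qscale (a * b) x.
Proof. by rewrite -[x]qreprK -!qprojZ scalerA. Qed.
Fact qscale1 : left_id 1 qscale.
Proof. by move=> x; rewrite -[x]qreprK -!qprojZ scale1r. Qed.
Fact qscaleDr : right_distributive qscale +%R.
Proof.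
move=> a x y.
by rewrite -[x]qreprK -[y]qreprK -qprojD -!qprojZ -qprojD scalerDr.
Qed.
Fact qscaleDl (x : quotmod) : {morph qscale^~ x : a b / a + b}.
Proof. by move=> a b; rewrite -[x]qreprK -!qprojZ -qprojD scalerDl. Qed.

HB.instance Definition _ :=
  GRing.Zmodule_isLmodule.Build R quotmod qscaleA qscale1 qscaleDr qscaleDl.

Fact qproj_is_linear : linear qproj.
Proof. by move=> a x y; rewrite qprojD qprojZ. Qed.
HB.instance Definition _ :=
  GRing.isLinear.Build R V quotmod _ qproj qproj_is_linear.

Lemma qproj0P (x : V) : reflect (qproj x = 0) (x \in span).
Proof. by rewrite -[x in x \in _]subr0 -(linear0 qproj); exact: qprojP. Qed.

Lemma qproj_rel (x y : V) : S (x - y) -> qproj x = qproj y.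
Proof. by move=> Sxy; apply/qprojP/sub_span. Qed.

Variables (W : lmodType R) (f : {linear V -> W}).
Hypothesis fS : forall x, S x -> f x = 0.

Lemma span_sub_ker (x : V) : x \in span -> f x = 0.
Proof.
move=> /spanP /(_ [set y | f y = 0]); apply; last exact: fS.
by split=> [|a u v /= fu fv] /=; rewrite ?linear0// linearP fu fv scaler0 addr0.
Qed.

Definition qlift of (forall x, S x -> f x = 0) : quotmod -> W := f \o qrepr.

Lemma qliftE (x : V) : qlift fS (qproj x) = f x.
Proof.
apply/eqP; rewrite -subr_eq0 -linearB; apply/eqP/span_sub_ker/qprojP.
exact: qreprK.
Qed.

Fact qlift_is_linear : linear (qlift fS).
Proof.
move=> a x y; rewrite -[x]qreprK -[y]qreprK -linearP !qliftE.
exact: linearP.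
Qed.
HB.instance Definition _ :=
  GRing.isLinear.Build R quotmod W _ (qlift fS) qlift_is_linear.

End Quotient.
Arguments qproj {R V} S x.
Arguments qlift {R V S W} f _ _.

Section Kernel.
Variables (R : pzRingType) (V W : lmodType R) (f : {linear V -> W}).

Definition ker_pred : {pred V} := [pred x | f x == 0].
Fact ker_submod_closed : GRing.submod_closed ker_pred.
Proof.
split=> [|a x y /eqP fx /eqP fy]; apply/eqP; first exact: linear0.
by rewrite linearP fx fy scaler0 addr0.
Qed.
HB.instance Definition _ :=
  GRing.isSubmodClosed.Build R V ker_pred ker_submod_closed.

Record ker : Type := Ker { ker_val : V; _ : ker_val \in ker_pred }.
HB.instance Definition _ := [isSub for ker_val].
HB.instance Definition _ := [Choice of ker by <:].
HB.instance Definition _ := [SubChoice_isSubLmodule of ker by <:].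

End Kernel.

(* The homology of U --f--> V --g--> W at V, for g \o f = 0. *)
Definition hlgy (R : pzRingType) (U V W : lmodType R)
    (f : {linear U -> V}) (g : {linear V -> W}) : lmodType R :=
  quotmod [set z : ker g | exists u : U, val z = f u].

Record complex (R : pzRingType) := Complex {
  cpx_obj :> nat -> lmodType R;
  cpx_d : forall n, {linear cpx_obj n.+1 -> cpx_obj n};
  cpx_dd : forall n x, cpx_d n (cpx_d n.+1 x) = 0
}.

Definition cpx_homology (R : pzRingType) (C : complex R) (n : nat) : lmodType R :=
  match n with
  | 0 => hlgy (cpx_d C 0) (\0 : {linear C 0 -> C 0})
  | m.+1 => hlgy (cpx_d C m.+1) (cpx_d C m)
  end.

Section Free.
Variables (R : nzRingType) (K : choiceType).

Definition freemod : lmodType R := malg K R.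
Definition fbasis (k : K) : freemod := mkmalgU k 1.

Variables (V : lmodType R) (h : K -> V).

Definition flift (u : freemod) : V := \sum_(k <- msupp u) mcoeff k u *: h k.

Lemma fliftEw (u : freemod) (A : {fset K}) : (msupp u `<=` A)%fset ->
  flift u = \sum_(k <- A) mcoeff k u *: h k.
Proof.
move=> uA; rewrite /flift (big_fset_incl _ uA)// => k _ ku.
by rewrite mcoeff_outdom// scale0r.
Qed.

Fact flift_is_linear : linear flift.
Proof.
move=> a u v; pose A := (msupp u `|` msupp v `|` msupp (a *: u + v))%fset.
rewrite !(@fliftEw _ A); last first.
- exact: fsubsetUr.
- by rewrite /A -fsetUA fsubsetUl.
- by rewrite /A fsetUAC fsubsetUr.
rewrite scaler_sumr -big_split /=; apply: eq_bigr => k _.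
by rewrite mcoeffD mcoeffZ scalerDl scalerA.
Qed.
HB.instance Definition _ :=
  GRing.isLinear.Build R freemod V _ flift flift_is_linear.

Lemma flift_basis (k : K) : flift (fbasis k) = h k.
Proof.
rewrite (@fliftEw _ [fset k]%fset) ?msuppU_le// big_seq_fset1.
by rewrite mcoeffUU scale1r.
Qed.

Lemma freemod_ext (f g : {linear freemod -> V}) :
  (forall k, f (fbasis k) = g (fbasis k)) -> f =1 g.
Proof.
move=> fg u; rewrite [u]monalgE !linear_sum; apply: eq_bigr => k _.
have -> : mkmalgU k (mcoeff k u) = mcoeff k u *: fbasis k.
  by apply/malgP => k'; rewrite mcoeffZ !mcoeffU mulrnAr mulr1.
by rewrite !linearZ fg.
Qed.

End Free.

Section Tensor.
Variables (R : comNzRingType) (V W : lmodType R).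

Definition tgen (x : V) (y : W) : freemod R (V * W)%type := fbasis R (x, y).
Local Notation e := tgen.

Inductive tens_rel : set (freemod R (V * W)%type) :=
| TensRelDl (x x' : V) (y : W) : tens_rel (e (x + x') y - (e x y + e x' y))
| TensRelDr (x : V) (y y' : W) : tens_rel (e x (y + y') - (e x y + e x y'))
| TensRelZl (a : R) (x : V) (y : W) : tens_rel (e (a *: x) y - a *: e x y)
| TensRelZr (a : R) (x : V) (y : W) : tens_rel (e x (a *: y) - a *: e x y).

Definition tensor : lmodType R := quotmod tens_rel.
Definition tens (x : V) (y : W) : tensor := qproj tens_rel (e x y).

Lemma tensDl (x x' : V) (y : W) : tens (x + x') y = tens x y + tens x' y.
Proof. by rewrite -linearD; apply/qproj_rel/TensRelDl. Qed.

Lemma tensDr (x : V) (y y' : W) : tens x (y + y') = tens x y + tens x y'.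
Proof. by rewrite -linearD; apply/qproj_rel/TensRelDr. Qed.

Lemma tensZl (a : R) (x : V) (y : W) : tens (a *: x) y = a *: tens x y.
Proof. by rewrite -linearZ; apply/qproj_rel/TensRelZl. Qed.

Lemma tensZr (a : R) (x : V) (y : W) : tens x (a *: y) = a *: tens x y.
Proof. by rewrite -linearZ; apply/qproj_rel/TensRelZr. Qed.

End Tensor.

Lemma quotmod_ext (R : pzRingType) (V W : lmodType R) (S : set V)
    (f g : {linear quotmod S -> W}) :
  (forall x, f (qproj S x) = g (qproj S x)) -> f =1 g.
Proof. by move=> fg x; rewrite -[x]qreprK. Qed.

Lemma tensor_ext (R : comNzRingType) (V W M : lmodType R)
    (f g : {linear tensor V W -> M}) :
  (forall x y, f (tens x y) = g (tens x y)) -> f =1 g.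
Proof.
move=> fg; apply: quotmod_ext => u.
apply: (freemod_ext (f := f \o qproj _) (g := g \o qproj _)) => -[x y].
exact: fg.
Qed.

Section TensorMap.
Variables (R : comNzRingType) (V V' W : lmodType R) (f : {linear V -> V'}).

Let tf (k : V * W) : tensor V' W := tens (f k.1) k.2.

Fact tmap_rel (u : freemod R (V * W)%type) : tens_rel u -> flift tf u = 0.
Proof.
by case=> [x x' y|x y y'|a x y|a x y];
  rewrite linearB ?linearD ?linearZ /tgen /= !flift_basis /tf /= ?linearD
    ?linearZ ?tensDl ?tensDr ?tensZl ?tensZr -?opprD ?scalerN subrr.
Qed.

Definition tmap : tensor V W -> tensor V' W := qlift (flift tf) tmap_rel.
HB.instance Definition _ := GRing.Linear.on tmap.

Lemma tmapE (x : V) (y : W) : tmap (tens x y) = tens (f x) y.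
Proof. by rewrite [LHS]qliftE /= flift_basis. Qed.

End TensorMap.
Arguments tmap {R V V'} W f _ : simpl never.

Lemma tmap_comp0 (R : comNzRingType) (U V V' W : lmodType R)
    (g : {linear V -> V'}) (f : {linear U -> V}) :
  (forall u, g (f u) = 0) -> forall x, tmap W g (tmap W f x) = 0.
Proof.
move=> gf; apply: (tensor_ext (f := tmap W g \o tmap W f) (g := \0)) => u w /=.
by rewrite !tmapE gf -(scale0r 0) tensZl scale0r.
Qed.

Definition cpx_tensor (R : comNzRingType) (C : complex R) (W : lmodType R) :
    complex R :=
  @Complex R (fun n => tensor (C n) W) (fun n => tmap W (cpx_d C n))
    (fun n => tmap_comp0 (@cpx_dd R C n)).

Section FreeResolution.
Variables (R : comNzRingType) (V : lmodType R).

Definition feval (U : lmodType R) : freemod R U -> U := flift (@id U).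
HB.instance Definition _ (U : lmodType R) := GRing.Linear.on (@feval U).

(* The canonical free resolution of V: its n-th term is free on the n-th syzygy
   K_n, where K_0 = V and K_(n+1) is the kernel of the evaluation
   map R^(K_n) -> K_n. *)
Fixpoint syzygy (n : nat) : lmodType R :=
  if n is m.+1 then ker (@feval (syzygy m)) else V.

Definition freeres_d (n : nat) : freemod R (syzygy n.+1) -> freemod R (syzygy n) :=
  (val : ker _ -> _) \o @feval (syzygy n.+1).
HB.instance Definition _ (n : nat) := GRing.Linear.on (@freeres_d n).

Fact freeres_dd (n : nat) (x : freemod R (syzygy n.+2)) :
  freeres_d (freeres_d x) = 0.
Proof.
apply: (congr1 val (x := feval (val (feval x))) (y := 0)).
exact/eqP/(valP (feval x)).
Qed.

Definition freeres : complex R :=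
  @Complex R (fun n => freemod R (syzygy n)) (fun n => @freeres_d n) freeres_dd.

End FreeResolution.

Definition Tor (R : comNzRingType) (n : nat) (V W : lmodType R) : lmodType R :=
  cpx_homology (cpx_tensor (freeres V) W) n.

(* V 0 (+) ... (+) V (n - 1) *)
Fixpoint dsum (R : pzRingType) (V : nat -> lmodType R) (n : nat) : lmodType R :=
  if n is m.+1 then (dsum V m * V m)%type else 'rV[R]_0.

HB.mixin Record isTopologicalGroup G of Topological G & Group G := {
  mulg_continuous : continuous (fun x : G * G => (x.1 * x.2)%g);
  invg_continuous : continuous (fun x : G => (x^-1)%g)
}.

#[short(type="topologicalGroupType")]
HB.structure Definition TopologicalGroup :=
  {G of Topological G & Group G & isTopologicalGroup G}.

Section ProductGroup.
Variables G H : topologicalGroupType.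

Fact prod_mulg_continuous :
  continuous (fun x : (G * H) * (G * H) => (x.1 * x.2)%g : G * H).
Proof.
move=> x.
apply: (@cvg_pair _ _ _ (nbhs x) (nbhs _) (nbhs _) _ _ _
  (fun y : (G * H) * (G * H) => (y.1.1 * y.2.1)%g)
  (fun y : (G * H) * (G * H) => (y.1.2 * y.2.2)%g)).
- apply: (@continuous_comp _ _ _ (fun y : (G * H) * (G * H) => (y.1.1, y.2.1))
    (fun y : G * G => (y.1 * y.2)%g)); last exact: mulg_continuous.
  by apply: (@cvg_pair _ _ _ (nbhs x) (nbhs _) (nbhs _) _ _ _
    (fun y : (G * H) * (G * H) => y.1.1) (fun y : (G * H) * (G * H) => y.2.1));
    [apply: (@continuous_comp _ _ _ fst fst)|apply: (@continuous_comp _ _ _ snd fst)];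
    first [exact: cvg_fst|exact: cvg_snd].
- apply: (@continuous_comp _ _ _ (fun y : (G * H) * (G * H) => (y.1.2, y.2.2))
    (fun y : H * H => (y.1 * y.2)%g)); last exact: mulg_continuous.
  by apply: (@cvg_pair _ _ _ (nbhs x) (nbhs _) (nbhs _) _ _ _
    (fun y : (G * H) * (G * H) => y.1.2) (fun y : (G * H) * (G * H) => y.2.2));
    [apply: (@continuous_comp _ _ _ fst snd)|apply: (@continuous_comp _ _ _ snd snd)];
    first [exact: cvg_fst|exact: cvg_snd].
Qed.

Fact prod_invg_continuous : continuous (fun x : G * H => (x^-1)%g : G * H).
Proof.
move=> x.
apply: (@cvg_pair _ _ _ (nbhs x) (nbhs _) (nbhs _) _ _ _
  (fun y : G * H => (y.1^-1)%g) (fun y : G * H => (y.2^-1)%g)).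
- apply: (@continuous_comp _ _ _ (fst : G * H -> G) (fun y : G => (y^-1)%g));
    last exact: invg_continuous.
  exact: cvg_fst.
- apply: (@continuous_comp _ _ _ (snd : G * H -> H) (fun y : H => (y^-1)%g));
    last exact: invg_continuous.
  exact: cvg_snd.
Qed.

HB.instance Definition _ := isTopologicalGroup.Build (G * H)%type
  prod_mulg_continuous prod_invg_continuous.

End ProductGroup.

Definition tdlc (G : topologicalGroupType) : Prop :=
  totally_disconnected [set: G] /\ locally_compact [set: G].

Section DiscreteModules.
Variable G : topologicalGroupType.

(* A left Q[G]-module structure is given as a Q-linear action of G. *)
Record discMod := DiscMod {
  dm_car :> lmodType rat;
  dm_act : G -> {linear dm_car -> dm_car};
  dm_act1 : forall x, dm_act 1%g x = x;
  dm_actM : forall g h x, dm_act (g * h)%g x = dm_act g (dm_act h x);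
  dm_stab_open : forall x, open [set g | dm_act g x = x]
}.

Record discHom (M N : discMod) := DiscHom {
  dh_fun :> {linear M -> N};
  dh_act : forall g x, dh_fun (dm_act M g x) = dm_act N g (dh_fun x)
}.

(* The epimorphisms of discrete modules are the surjective morphisms. *)
Definition dm_projective (P : discMod) : Prop :=
  forall (A B : discMod) (p : discHom A B) (f : discHom P B),
    (forall b, exists a, p a = b) ->
    exists h : discHom P A, forall x, p (h x) = f x.

Record projRes (M : discMod) := ProjRes {
  pr_obj :> nat -> discMod;
  pr_d : forall n, discHom (pr_obj n.+1) (pr_obj n);
  pr_aug : discHom (pr_obj 0%N) M;
  pr_proj : forall n, dm_projective (pr_obj n);
  pr_aug_surj : forall m, exists x, pr_aug x = m;
  pr_exact0 : forall x, pr_aug x = 0 <-> exists y, pr_d 0 y = x;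
  pr_exactS : forall n x, pr_d n x = 0 <-> exists y, pr_d n.+1 y = x
}.

(* P (x)_G M, where P is a right module through p . g = g^-1 p. *)
Definition gtens_rel (P M : discMod) : set (tensor P M) :=
  [set z | exists g p m,
     z = tens (dm_act P g^-1%g p) m - tens p (dm_act M g m)].

Arguments gtens_rel : clear implicits.

Definition gtensor (P M : discMod) : lmodType rat := quotmod (gtens_rel P M).

Section GTensorMap.
Variables (P Q M : discMod) (f : discHom P Q).

Fact gtmap_rel (z : tensor P M) :
  gtens_rel P M z -> (qproj (gtens_rel Q M) \o tmap M f) z = 0.
Proof.
move=> [g [p [m ->]]]; rewrite /=; apply/qproj0P/sub_span.
by rewrite linearB /= !tmapE dh_act; exists g, (f p), m.
Qed.

Definition gtmap : gtensor P M -> gtensor Q M :=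
  qlift (qproj (gtens_rel Q M) \o tmap M f) gtmap_rel.
HB.instance Definition _ := GRing.Linear.on gtmap.

End GTensorMap.
Arguments gtmap {P Q} M f _ : simpl never.

Lemma gtmapE (P Q M : discMod) (f : discHom P Q) (z : tensor P M) :
  gtmap M f (qproj _ z) = qproj _ (tmap M f z).
Proof. exact: qliftE. Qed.

Section RationalDiscreteHomology.
Variables (N M : discMod) (P : projRes N).

Fact gtmap_dd (n : nat) (x : gtensor (P n.+2) M) :
  gtmap M (pr_d P n) (gtmap M (pr_d P n.+1) x) = 0.
Proof.
apply: (quotmod_ext (f := gtmap M (pr_d P n) \o gtmap M (pr_d P n.+1)) (g := \0)).
move=> z /=; rewrite !gtmapE tmap_comp0 ?linear0// => u.
by apply/(@pr_exactS _ P); exists u.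
Qed.

Definition pr_gtensor : complex rat :=
  @Complex rat (fun n => gtensor (P n) M) (fun n => gtmap M (pr_d P n)) gtmap_dd.

End RationalDiscreteHomology.

Fact trivQ_stab_open (x : rat^o) :
  open [set g : G | (idfun : rat^o -> rat^o) x = x].
Proof. by rewrite (_ : [set _ | _] = setT) ?predeqE//; exact: openT. Qed.

Definition trivQ : discMod :=
  @DiscMod rat^o (fun _ => idfun) (fun _ => erefl) (fun _ _ _ => erefl)
    trivQ_stab_open.

(* dH_n(G, M), computed from a given projective resolution P of the trivial
   module; up to isomorphism it does not depend on P. *)
Definition dH (P : projRes trivQ) (n : nat) (M : discMod) : lmodType rat :=
  cpx_homology (pr_gtensor M P) n.

End DiscreteModules.
Arguments trivQ G : clear implicits.

(* Main.v *)
(* Tensoring projective resolutions P -> Q over G and P' -> Q over H gives a complex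
   P (x) P' of discrete G x H-modules. It is exact because over the field Q every
   complex is homotopy equivalent to its homology. It consists of projectives:
   maps P_p (x) P'_q -> A are maps from P_p to the smooth vectors of Hom_H(P'_q, A),
   and lifting through a surjection A -> B is possible since, by van Dantzig,
   compact open subgroups K form a base at 1, and averaging over K makes
   A^K -> B^K surjective. So P (x) P' computes dH(G x H, Q). Its G x H-coinvariants
   are P_G (x) P'_H, whose homology is the tensor product of the homologies, again
   by splitting both factors over Q; the Tor terms vanish as Q is a field. *)
Require Import Defs.
From HB Require Import structures.
From mathcomp Require Import all_boot all_order all_algebra.
From mathcomp Require Import finmap all_classical topology.
Set Implicit Arguments.
Unset Strict Implicit.
Unset Printing Implicit Defensive.
Import GRing.Theory Num.Theory.
Local Open Scope classical_set_scope.
Local Open Scope ring_scope.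

(** * Compact open subgroups *)

(** The Kunneth lemma [kunneth_computes] is used twice. Applied to the two resolutions as bare
    complexes of vector spaces, with homology concentrated in degree 0, it gives exactness of the
    tensor complex; the group actions are forgotten there, because the splittings are not
    equivariant. Applied to the two complexes of coinvariants, it gives the answer. The spaces may
    have infinite dimension, so splitting them takes Zorn's lemma. As [PGH] is an arbitrary
    resolution, chain maps and homotopies between resolutions are built to pass to it from the
    tensor resolution. The rationals matter in two ways: as a field in the splittings, and by
    characteristic zero in the averages over finite orbits. *)

Section QuasiComponent.
Variables (T : topologicalType) (V : set T) (x : T).
Hypotheses (cV : compact V) (clV : closed V) (Vx : V x).

(** As [V] is closed, being clopen in [V] is expressed by two closed sets of the ambient space,
    without a subspace topology. *)
Definition rel_clopen (D : set T) :=
  [/\ D `<=` V, D x, closed D & closed (V `\` D)].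
Definition quasi_component := \bigcap_(D in rel_clopen) D.

Lemma rel_clopenT : rel_clopen V.
Proof. by split=> //; rewrite setDv; exact: closed0. Qed.

Lemma rel_clopenI A B : rel_clopen A -> rel_clopen B -> rel_clopen (A `&` B).
Proof.
move=> [AV Ax cA cAc] [BV Bx cB cBc]; split; [by move=> y [/AV]|by []|..].
  exact: closedI.
by rewrite setDIr; exact: closedU.
Qed.

(** Otherwise the closed sets [D \ O] generate a proper filter. By compactness it clusters at some
    [p], which then lies in all of them, hence in the quasi-component but outside [O]. *)
Lemma quasi_component_sub_open (O : set T) : open O -> quasi_component `<=` O ->
  exists2 D, rel_clopen D & D `<=` O.
Proof.
move=> oO QO; apply: contrapT => nD.
pose F := filter_from rel_clopen (fun D => D `\` O).
have FF : ProperFilter F.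
  apply: filter_from_proper; last first.
    move=> D rD; apply: contrapT => /nonemptyPn; rewrite setD_eq0 => DO.
    by apply: nD; exists D.
  apply: filter_from_filter; first by exists V; exact: rel_clopenT.
  move=> A B rA rB; exists (A `&` B); first exact: rel_clopenI.
  by move=> y [[Ay By] Oy].
have [|p [Vp clp]] := cV FF.
  by exists V; [exact: rel_clopenT|move=> y []].
have [D rD nDp] : exists2 D, rel_clopen D & ~ (D `\` O) p.
  have [Op|nOp] := pselect (O p); first by exists V; [exact: rel_clopenT|case].
  have : ~ quasi_component p by move=> /QO.
  move=> /existsNP[D /not_implyP[rD nDp]].
  by exists D => // -[].
have [cD oc] : closed (D `\` O) /\ F (D `\` O).
  split; last by exists D.
  by case: rD => _ _ cD _; apply: closedI => //; exact: open_closedC.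
have : nbhs p (~` (D `\` O)).
  by apply: open_nbhs_nbhs; split => //; exact: closed_openC.
by move=> /(clp _ _ oc) [y [h1 h2]]; apply: h2.
Qed.

End QuasiComponent.

Section TopGroup.
Variable G : topologicalGroupType.
Local Open Scope group_scope.

Lemma mulgl_continuous (g : G) : continuous (fun x : G => g * x).
Proof.
move=> x; apply: (@continuous_comp _ _ _ (fun x : G => (g, x))
  (fun z : G * G => z.1 * z.2)); last exact: mulg_continuous.
by apply: cvg_pair => /=; [exact: cvg_cst|exact: cvg_id].
Qed.

Lemma mulgr_continuous (g : G) : continuous (fun x : G => x * g).
Proof.
move=> x; apply: (@continuous_comp _ _ _ (fun x : G => (x, g))
  (fun z : G * G => z.1 * z.2)); last exact: mulg_continuous.
by apply: cvg_pair => /=; [exact: cvg_id|exact: cvg_cst].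
Qed.

Lemma nbhs1_invg (U : set G) : nbhs 1 U -> nbhs 1 [set g | U g^-1].
Proof. by move=> U1; apply: invg_continuous; rewrite invg1. Qed.

(** A tube lemma: near-covering compactness makes the neighbourhoods given by continuity at each
    [(c, (1, 1))] uniform in [c]. The factor [z.2^-1] is there for separating translates:
    [a * z.1 = b * z.2] gives [a * z.1 * z.2^-1 = b]. *)
Lemma compact_open_mulg (C O : set G) : compact C -> open O -> C `<=` O ->
  \forall z \near (1 : G, 1 : G), forall c, C c -> O (c * z.1 * z.2^-1).
Proof.
move=> /compact_near_coveringP cC oO CO.
apply: (cC _ (nbhs (1 : G, 1 : G)) (fun z c => O (c * z.1 * z.2^-1))) => c Cc.
have cont : {for (c, (1, 1)), continuous
    (fun w : G * (G * G) => w.1 * w.2.1 * w.2.2^-1)}.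
  have c1 : {for (c, (1, 1)), continuous (fun w : G * (G * G) => w.1 * w.2.1)}.
    apply: (@continuous_comp _ _ _ (fun w : G * (G * G) => (w.1, w.2.1))
      (fun z : G * G => z.1 * z.2)); last exact: mulg_continuous.
    apply: (@cvg_pair _ _ _ _ (nbhs _) (nbhs _)); first exact: cvg_fst.
    by apply: (@continuous_comp _ _ _ snd fst); [exact: cvg_snd|exact: cvg_fst].
  apply: (@continuous_comp _ _ _ (fun w : G * (G * G) => (w.1 * w.2.1, w.2.2^-1))
      (fun z : G * G => z.1 * z.2)); last exact: mulg_continuous.
  apply: (@cvg_pair _ _ _ _ (nbhs _) (nbhs _)); first exact: c1.
  apply: (@continuous_comp _ _ _ (fun w : G * (G * G) => w.2.2) (fun x => x^-1));
    last exact: invg_continuous.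
  by apply: (@continuous_comp _ _ _ snd snd); exact: cvg_snd.
apply: cont; apply: open_nbhs_nbhs; split=> //=.
by rewrite invg1 !mulg1; exact: CO.
Qed.

(** The group structure replaces a separation axiom: both sets are thickened by translates of one
    small open [N], and a common point would put some [b] of [B] into the complement of [B]. *)
Lemma separate_compact_closed (A B : set G) : compact A -> closed B ->
  A `&` B = set0 ->
  exists O1 O2, [/\ open O1, open O2, A `<=` O1, B `<=` O2 & O1 `&` O2 = set0].
Proof.
move=> cA clB AB.
have [|[N1 N2] /= [n1 n2] hN] := @compact_open_mulg A (~` B) cA (closed_openC clB).
  by apply/disjoints_subset.
pose N := (N1 `&` N2)^°.
have oN : open N by exact: open_interior.
have N_1 : N 1 by apply: nbhs_singleton; apply: nbhs_interior; exact: filterI.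
pose O (S : set G) := \bigcup_(s in S) [set x | N (s^-1 * x)].
have oO S : open (O S).
  apply: bigcup_open => s _; move/continuousP: (@mulgl_continuous s^-1).
  exact.
have sO S : S `<=` O S by move=> s Ss; exists s => //=; rewrite mulVg.
exists (O A), (O B); split; [exact: oO|exact: oO|exact: sO|exact: sO|].
apply/seteqP; split=> // y [[a Aa /= aN] [b Bb /= bN]].
have /interior_subset [aN1 _] := aN.
have /interior_subset [_ bN2] := bN.
have := hN (a^-1 * y, b^-1 * y) (conj aN1 bN2) a Aa; apply => /=.
by rewrite mulVKg -[X in X / _](mulVKg b) mulgK.
Qed.

(** Suppose [Q] is the disjoint union of closed [A], containing [x], and [B]. Separate them by open
    [O1] and [O2], and take a relatively clopen [D] inside their union. Then [D] meets [O1] in a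
    relatively clopen set containing [x], so [Q] lies in [O1] and [B] is empty. *)
Lemma quasi_component_connected (V : set G) (x : G) :
  compact V -> closed V -> V x -> connected (quasi_component V x).
Proof.
move=> cV clV Vx; set Q := quasi_component V x.
have clQ : closed Q by apply: closed_bigI => D [].
have QV : Q `<=` V by move=> y; apply; exact: rel_clopenT.
have Qx : Q x by move=> D [].
have key (A B : set G) : closed A -> closed B -> Q = A `|` B -> A `&` B = set0 ->
    A x -> B = set0.
  move=> cA cB QAB AB Ax.
  have [|O1 [O2 [oO1 oO2 AO1 BO2 O12]]] := @separate_compact_closed A B _ cB AB.
    by apply: (subclosed_compact cA cV) => y Ay; apply: QV; rewrite QAB; left.
  have QO : Q `<=` O1 `|` O2 by rewrite QAB => y [/AO1|/BO2]; [left|right].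
  have [D [DV Dx cD cDc] DO] :=
    quasi_component_sub_open cV clV Vx (openU oO1 oO2) QO.
  have QO1 : Q `<=` O1.
    suff rD : rel_clopen V x (D `&` O1) by move=> y /(_ _ rD) [].
    have -> : D `&` O1 = D `&` ~` O2.
      apply/seteqP; split=> y [Dy Oy]; split=> //.
        by move=> O2y; have : (O1 `&` O2) y by []; rewrite O12.
      by case: (DO _ Dy).
    split; [by move=> y [/DV]| | |].
    - split=> // O2x; have : (O1 `&` O2) x by split=> //; exact: AO1.
      by rewrite O12.
    - by apply: closedI => //; exact: open_closedC.
    have -> : V `\` (D `&` ~` O2) = (V `\` D) `|` (D `&` ~` O1).
      apply/seteqP; split=> [y [Vy nDy]|y [[Vy nDy]|[Dy nO1]]].
      - have [Dy|nDy'] := pselect (D y); [right|by left].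
        split=> // O1y; apply: nDy; split=> // O2y.
        by have : (O1 `&` O2) y by []; rewrite O12.
      - by split=> // -[].
      - by split; [exact: DV|move=> [_]]; case: (DO _ Dy).
    by apply: closedU => //; apply: closedI => //; exact: open_closedC.
  apply/seteqP; split=> // y By.
  have Qy : Q y by rewrite QAB; right.
  by have : (O1 `&` O2) y := conj (QO1 _ Qy) (BO2 _ By); rewrite O12.
(* [connected] asks that a nonempty [B], open and closed in [Q], be all of [Q]. [key] is applied to
   [B] and its complement, in the order that puts [x] in the first set. *)
move=> B [b Bb] [C oC BC] [D cD BD].
have cB : closed B by rewrite BD; exact: closedI.
have cB' : closed (Q `&` ~` C) by apply: closedI => //; exact: open_closedC.
have QE : Q = B `|` (Q `&` ~` C) by rewrite BC -setIUr setUCr setIT.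
have dj : B `&` (Q `&` ~` C) = set0.
  by rewrite BC; apply/seteqP; split=> // y [[_ h] [_]].
have [Bx|nBx] := pselect (B x).
  by rewrite [RHS]QE (key _ _ cB cB' QE dj Bx) setU0.
have Ax : (Q `&` ~` C) x by split=> // Cx; apply: nBx; rewrite BC.
rewrite setUC in QE; rewrite setIC in dj.
by move: Bb; rewrite (key _ _ cB' cB QE dj Ax).
Qed.

(* The quasi-component of 1 in a compact neighbourhood is connected, hence
   trivial, so 1 has a small compact open neighbourhood C (van Dantzig); the
   group K is the right stabiliser of C. *)
Lemma compact_open_subgroup (U : set G) : tdlc G -> nbhs (1 : G) U ->
  exists K C : set G, [/\ K 1, (forall x y, K x -> K y -> K (x * y)),
    (forall x, K x -> K x^-1), nbhs (1 : G) K & [/\ K `<=` C, C `<=` U & compact C]].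
Proof.
move=> [td lc] U1.
have [V [V1 cV clV]] : exists V : set G, [/\ nbhs (1 : G) V, compact V & closed V].
  have [V nV [cV clV]] : compact_near (within setT (nbhs (1 : G))) := lc 1 I.
  exists V; split=> //.
  by move: nV; rewrite withinET.
have Vx : V 1 by exact: nbhs_singleton.
pose W := (V `&` U)^°.
have W1 : W 1 by apply: nbhs_singleton; apply: nbhs_interior; exact: filterI.
have [||C [CV C1 cC cCc] CW] := @quasi_component_sub_open _ V 1 cV clV Vx W.
- exact: open_interior.
- have cQ := quasi_component_connected cV clV Vx.
  suff Q1 : quasi_component V 1 `<=` [set 1] by move=> y /Q1 ->.
  rewrite -(td 1 I); apply: connected_component_max => //.
  by move=> D [].
have oC : open C.
  rewrite (_ : C = W `&` ~` (V `\` C)).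
    by apply: openI; [exact: open_interior|exact: closed_openC].
  apply/seteqP; split=> [y Cy|y [/interior_subset [Vy _] nVC]].
    by split; [exact: CW|move=> []].
  by apply: contrapT => nCy; apply: nVC.
have kC : compact C by exact: (subclosed_compact cC cV).
have CU : C `<=` U by move=> y /CW /interior_subset [].
pose K := [set g : G | forall c, C (c * g) <-> C c].
have KC : K `<=` C by move=> g /(_ 1); rewrite mul1g => -[_]; apply.
have nK : nbhs 1 K.
  (* Right translation by elements close to 1 maps [C] into itself; applying this to inverses as
     well gives the equivalence that defines [K]. *)
  have [[N1 N2] /= [n1 n2] hN] := @compact_open_mulg C C kC oC (@subset_refl _ _).
  have nN : nbhs (1 : G) (N1 `&` N2) by exact: filterI.
  have h1 : nbhs 1 [set g | forall c, C c -> C (c * g)].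
    apply: filterS nN => g [N1g _] c Cc.
    have := hN (g, 1) (conj N1g (nbhs_singleton n2)) c Cc.
    by rewrite /= invg1 mulg1.
  have h2 := nbhs1_invg h1.
  apply: filterS (filterI h1 h2) => g [hg hg'] c; split=> [/hg'|/hg//].
  by rewrite -mulgA mulgV mulg1.
(* The compact set [C] is returned along with [K]: finiteness of [K]-orbits will be read off from
   it. *)
exists K, C; split=> //.
- by move=> c; rewrite mulg1.
- by move=> x y Kx Ky c; rewrite mulgA Ky.
- by move=> x Kx c; rewrite -[in C c](mulgVK x c) Kx.
Qed.

End TopGroup.

(** * Linear algebra over a field *)

Lemma inj_surj_bijective (A B : Type) (f : A -> B) :
  injective f -> (forall b, exists a, f a = b) -> bijective f.
Proof.
move=> fI /choice[g fg]; exists g => [a|b]; last exact: fg.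
by apply: fI; rewrite fg.
Qed.

Lemma dchoice (I : Type) (Y : I -> Type) (P : forall i, Y i -> Prop) :
  (forall i, exists y, P i y) -> exists f : forall i, Y i, forall i, P i (f i).
Proof.
by move=> h; exists (fun i => projT1 (cid (h i))) => i; exact: projT2 (cid (h i)).
Qed.

Definition mklin (R : pzRingType) (V W : lmodType R) (f : V -> W)
    (Lf : linear f) : {linear V -> W} :=
  HB.pack f (GRing.isLinear.Build R V W *:%R f Lf).

Section LinearLift.
Variable F : fieldType.

(* The partial section of f defined on its image is a maximal subspace meeting
   the kernel of f trivially. *)
Lemma linear_lift (U V W : lmodType F) (f : {linear V -> W})
    (p : {linear U -> W}) :
  (forall u, exists v, f v = p u) ->
  exists t : {linear U -> V}, forall u, f (t u) = p u.
Proof.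
move=> pf.
pose P (S : set V) := (forall a x y, S x -> S y -> S (a *: x + y)) /\
  (forall x, S x -> f x = 0 -> x = 0).
have [|S [[Slin Sker] Smax]] := @Zorn_bigcup V P.
  move=> C CP Ctot; split=> [a x y [A CA Ax] [B CB By]|x [A CA Ax]].
    have [AB|BA] := Ctot _ _ CA CB.
      by exists B => //; apply: (CP _ CB).1 => //; exact: AB.
    by exists A => //; apply: (CP _ CA).1 => //; exact: BA.
  exact: (CP _ CA).2.
(* [P] cannot ask for 0, since it must hold for the union of the empty chain. A nonempty [S]
   contains [-x + x], and an empty one is not maximal. *)
have S0 : S 0.
  apply: contrapT => nS0; apply: (Smax [set 0]).
    split=> [x Sx|]; last by move=> /(_ 0 erefl).
    by case: nS0; rewrite -(addNr x) -scaleN1r; exact: Slin.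
  by split=> [a x y -> ->|x ->]//; rewrite scaler0 addr0.
(* If [f v] is not a value of [f] on [S], adjoining the line of [v] keeps the kernel condition:
   [f (s + b *: v) = 0] with [b] nonzero would make [f v] the value at [- b^-1 *: s]. *)
have Ssurj v : exists2 s, S s & f s = f v.
  apply: contrapT => nv.
  pose S' := [set x | exists s a, S s /\ x = s + a *: v].
  apply: (Smax S').
    split=> [x Sx|]; first by exists x, 0; rewrite scale0r addr0.
    move=> /(_ v) S'v; apply: nv; exists v => //; apply: S'v.
    by exists 0, 1; rewrite add0r scale1r.
  split=> [a _ _ [s [b [Ss ->]]] [s' [b' [Ss' ->]]]|_ [s [b [Ss ->]]]].
    exists (a *: s + s'), (a * b + b'); split; first exact: Slin.
    by rewrite scalerDr scalerDl scalerA addrACA.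
  have [->|b0] := eqVneq b 0; first by rewrite scale0r addr0; exact: Sker.
  rewrite linearD linearZ /= => /eqP; rewrite addrC addr_eq0 => /eqP fv.
  case: nv; exists (- b^-1 *: s).
    by rewrite -[_ *: _]addr0; exact: Slin.
  by rewrite linearZ/= scaleNr -scalerN -fv scalerA mulVf// scale1r.
have /choice[t tP] u : exists s, S s /\ f s = p u.
  by have [v <-] := pf u; have [s Ss <-] := Ssurj v; exists s.
have Lt : linear t.
  move=> a u v; apply/eqP; rewrite -subr_eq0; apply/eqP/Sker.
    rewrite [_ - _]addrC -scaleN1r; apply: (Slin); last exact: (tP _).1.
    by apply: Slin; exact: (tP _).1.
  by rewrite linearB linearP !(tP _).2 linearP subrr.
by exists (mklin Lt) => u; exact: (tP u).2.
Qed.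

(** Such a [g] encodes complements of kernel and image at once: [1 - g f] projects onto the kernel.
    With [t] a section of the quotient by the image, [1 - t pi] has its values in the image and
    lifts through [f]. *)
Lemma generalized_inverse (V W : lmodType F) (f : {linear V -> W}) :
  exists g : {linear W -> V}, forall v, f (g (f v)) = f v.
Proof.
pose pi : {linear W -> quotmod (range f)} := qproj (range f).
have [|t tK] := @linear_lift _ _ _ pi (idfun : {linear _ -> quotmod (range f)}).
  by move=> u; exists (qrepr u); exact: qreprK.
have [|g gP] := @linear_lift _ _ _ f (idfun \- (t \o pi)).
  move=> w; have /qproj0P/Defs.spanP/(_ (range f)) : pi (w - t (pi w)) = 0.
    by rewrite linearB tK subrr.
  move=> h; suff [v _ vE] : range f (w - t (pi w)) by exists v.
  apply: h => //.
  split; first by exists 0 => //; exact: linear0.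
  by move=> a _ _ [x _ <-] [y _ <-]; exists (a *: x + y) => //; exact: linearP.
exists g => v; rewrite gP/=.
have -> : pi (f v) = 0 by apply/qproj0P/Defs.sub_span; exists v.
by rewrite linear0 subr0.
Qed.

End LinearLift.

Section Homology.
Variable F : fieldType.

Definition cpx_cycle (R : pzRingType) (C : complex R) (n : nat) : C n -> Prop :=
  match n with 0 => fun=> True | m.+1 => fun x => cpx_d C m x = 0 end.

(* phi induces an isomorphism from the n-th homology of C to H. *)
Definition computes (C : complex F) (n : nat) (H : lmodType F)
    (phi : {linear C n -> H}) :=
  (forall h, exists2 x, cpx_cycle x & phi x = h) /\
  (forall x, cpx_cycle x -> (phi x = 0 <-> exists y, x = cpx_d C n y)).

Lemma hlgy_bijective (U V W H : lmodType F) (f : {linear U -> V})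
    (g : {linear V -> W}) (phi : {linear V -> H}) :
  (forall h, exists2 x, g x = 0 & phi x = h) ->
  (forall x, g x = 0 -> (phi x = 0 <-> exists y, x = f y)) ->
  exists k : {linear hlgy f g -> H}, bijective k.
Proof.
move=> phis phik.
have kB z : [set z : ker g | exists u, val z = f u] z -> (phi \o val) z = 0.
  by move=> [u zu] /=; apply/phik; [exact/eqP/(valP z)|exists u].
pose k : {linear hlgy f g -> H} := qlift (phi \o val) kB.
have kE z : k (qproj _ z) = phi (val z) by exact: qliftE.
exists k; apply: inj_surj_bijective => [x y|h].
  rewrite -[x]qreprK -[y]qreprK !kE => xy; apply: qproj_rel.
  apply/phik; last by rewrite linearB /= xy subrr.
  exact/eqP/(valP (qrepr x - qrepr y)).
have [x gx <-] := phis h; have kx : x \in ker_pred g by exact/eqP.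
by exists (qproj _ (Ker kx)); rewrite kE.
Qed.

Lemma computes_bijective (C : complex F) (n : nat) (H : lmodType F)
    (phi : {linear C n -> H}) :
  computes phi -> exists k : {linear cpx_homology C n -> H}, bijective k.
Proof.
case: n phi => [|n] phi [h1 h2]; apply: (@hlgy_bijective _ _ _ _ _ _ phi) => //.
- by move=> h; have [x _ <-] := h1 h; exists x.
- by move=> x _; exact: h2.
Qed.

(** The class map lives on [ker g]. Precomposing with the projection [x - s (g x)] extends it to all
    of [V], as [computes] requires. *)
Lemma hlgy_projection (U V W : lmodType F) (f : {linear U -> V})
    (g : {linear V -> W}) : exists phi : {linear V -> hlgy f g},
  (forall h, exists2 x, g x = 0 & phi x = h) /\
  (forall x, g x = 0 -> (phi x = 0 <-> exists y, x = f y)).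
Proof.
have [s sP] := generalized_inverse g.
have kx x : x - s (g x) \in ker_pred g.
  by apply/eqP; rewrite linearB sP subrr.
have Lz : linear (fun x => Ker (kx x)).
  move=> a x y; apply: val_inj.
  by rewrite /= (linearP g) (linearP s) scalerBr opprD addrACA.
exists (qproj _ \o mklin Lz); split=> [h|x gx].
  exists (val (qrepr h)); first exact/eqP/(valP (qrepr h)).
  rewrite -[RHS]qreprK /=; congr (qproj _ _); apply: val_inj => /=.
  by rewrite (eqP (valP (qrepr h))) linear0 subr0.
split=> [/qproj0P|[y xy]].
  move=> /Defs.spanP/(_ [set z : ker g | exists u, val z = f u]) [|//|u /=].
    split; first by exists 0; rewrite linear0.
    move=> a z z' [u zu] [u' zu']; exists (a *: u + u').
    by rewrite (linearP f) -zu -zu'.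
  by rewrite gx linear0 subr0 => ->; exists u.
by apply/qproj0P/Defs.sub_span; exists y; rewrite /= gx linear0 subr0.
Qed.

Lemma computes_homology (C : complex F) (n : nat) :
  exists phi : {linear C n -> cpx_homology C n}, computes phi.
Proof.
case: n => [|n].
  have [phi [h1 h2]] := hlgy_projection (cpx_d C 0) (\0 : {linear C 0 -> C 0}).
  exists phi; split=> [h|x _]; last exact: h2.
  by have [x _ <-] := h1 h; exists x.
exact: hlgy_projection.
Qed.

(* A homotopy equivalence of C with H, where H has zero differential. *)
Definition splitting (C : complex F) (H : nat -> lmodType F)
    (r : forall n, {linear C n -> H n}) (i : forall n, {linear H n -> C n})
    (s : forall n, {linear C n -> C n.+1}) :=
  [/\ forall n h, r n (i n h) = h,
      forall n x, r n (cpx_d C n x) = 0,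
      forall n h, cpx_d C n (i n.+1 h) = 0,
      forall x, x - i 0%N (r 0%N x) = cpx_d C 0 (s 0%N x) &
      forall n x, x - i n.+1 (r n.+1 x) =
        cpx_d C n.+1 (s n.+1 x) + s n (cpx_d C n x)].

Lemma cpx_cycle_d (C : complex F) n x : cpx_cycle (cpx_d C n x).
Proof. by case: n x => //= n x; rewrite cpx_dd. Qed.

Lemma cpx_cycleP (C : complex F) n a (x y : C n) :
  cpx_cycle x -> cpx_cycle y -> cpx_cycle (a *: x + y).
Proof.
by case: n x y => //= n x y cx cy; rewrite linearP cx cy scaler0 addr0.
Qed.

Lemma cpx_cycle_section (C : complex F) n (H : lmodType F)
    (phi : {linear C n -> H}) : computes phi ->
  exists i : {linear H -> C n}, forall h, cpx_cycle (i h) /\ phi (i h) = h.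
Proof.
case: n phi => [|n] phi [phis _].
  have [|i iP] := @linear_lift _ _ _ _ phi (idfun : {linear H -> H}).
    by move=> h; have [x _ <-] := phis h; exists x.
  by exists i.
pose psi : {linear ker (cpx_d C n) -> H} := phi \o val.
have [|i iP] := @linear_lift _ _ _ _ psi (idfun : {linear H -> H}).
  move=> h; have [x cx <-] := phis h.
  have kx : x \in ker_pred (cpx_d C n) by exact/eqP.
  by exists (Ker kx).
by exists (val \o i) => h; split; [exact/eqP/(valP (i h))|exact: iP].
Qed.

(** Each [C n] splits into boundaries, the image of [i] and a complement of the cycles. [pv]
    projects onto that complement, so [x - pv x - i (r x)] is the boundary part of [x], and [s]
    picks a preimage of it. Agreement of [r] with [phi] on cycles later recovers the
    augmentation. *)
Lemma computes_splitting (C : complex F) (H : nat -> lmodType F)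
    (phi : forall n, {linear C n -> H n}) :
  (forall n, computes (phi n)) ->
  exists r i s, @splitting C H r i s /\
    forall n x, cpx_cycle x -> r n x = phi n x.
Proof.
move=> phiP.
have [sg sgP] := dchoice (fun n => generalized_inverse (cpx_d C n)).
have [i iP] := dchoice (fun n => cpx_cycle_section (phiP n)).
pose pv n : {linear C n -> C n} :=
  match n with 0 => \0 | m.+1 => sg m \o cpx_d C m end.
have pv0 n x : cpx_cycle x -> pv n x = 0.
  by case: n x => //= n x ->; rewrite linear0.
have pvc n x : cpx_cycle (x - pv n x).
  by case: n x => //= n x; rewrite linearB sgP subrr.
pose r n : {linear C n -> H n} := phi n \o (idfun \- pv n).
pose s n : {linear C n -> C n.+1} := sg n \o (idfun \- pv n \- (i n \o r n)).
have rE n x : cpx_cycle x -> r n x = phi n x.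
  by move=> cx; rewrite /r /= pv0// subr0.
have rd n x : r n (cpx_d C n x) = 0.
  rewrite rE; last exact: cpx_cycle_d.
  by apply/(phiP n).2; [exact: cpx_cycle_d|exists x].
have ri n h : r n (i n h) = h by rewrite rE; case: (iP n h).
have h n x : x - i n (r n x) = cpx_d C n (s n x) + pv n x.
  rewrite /s /= -[cpx_d _ _ _ + _]addrC -[LHS](subrK (pv n x)).
  rewrite addrC; congr (_ + _); rewrite addrAC.
  have : phi n (x - pv n x - i n (r n x)) = 0.
    by rewrite linearB (iP n _).2 /r /= subrr.
  move/(phiP n).2 => [|y ->]; last by rewrite sgP.
  rewrite [_ - i n _]addrC -scaleN1r; apply: cpx_cycleP; first exact: (iP n _).1.
  exact: pvc.
exists r, i, s; split=> //; split=> //.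
- by move=> n x; have [] := iP n.+1 x.
- by move=> x; rewrite h /= addr0.
- move=> n x; rewrite h; congr (_ + _).
  have -> : s n (cpx_d C n x) = sg n (cpx_d C n x - pv n (cpx_d C n x)
    - i n (r n (cpx_d C n x))) by [].
  by rewrite rd linear0 subr0 (pv0 _ _ (cpx_cycle_d x)) subr0.
Qed.

(** Asking for inverses only up to boundaries, and only on cycles, covers both homotopy equivalences
    and isomorphisms of complexes. *)
Lemma computes_transport (C D : complex F) (H : lmodType F)
    (f : forall n, {linear D n -> C n}) (g : forall n, {linear C n -> D n}) n
    (phi : {linear C n -> H}) :
  (forall n x, f n (cpx_d D n x) = cpx_d C n (f n.+1 x)) ->
  (forall n x, g n (cpx_d C n x) = cpx_d D n (g n.+1 x)) ->
  (forall x : C n, cpx_cycle x -> exists y, x - f n (g n x) = cpx_d C n y) ->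
  (forall x : D n, cpx_cycle x -> exists y, x - g n (f n x) = cpx_d D n y) ->
  computes phi -> computes (phi \o f n).
Proof.
move=> fd gd fg gf [phis phik].
have fc x : cpx_cycle x -> cpx_cycle (f n x).
  by case: n x {phi phis phik fg gf} => //= n x; rewrite -fd => ->; exact: linear0.
have gc x : cpx_cycle x -> cpx_cycle (g n x).
  by case: n x {phi phis phik fg gf fc} => //= n x; rewrite -gd => ->; exact: linear0.
have phid y : phi (cpx_d C n y) = 0.
  by apply/phik; [exact: cpx_cycle_d|exists y].
split=> [h|x cx] /=.
  have [x cx <-] := phis h; exists (g n x); first exact: gc.
  have [y xy] := fg _ cx.
  have -> : f n (g n x) = x - cpx_d C n y by rewrite -xy opprB addrC subrK.
  by rewrite linearB phid subr0.
split=> [/(phik _ (fc _ cx))[y fy]|[y ->]]; last by rewrite fd phid.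
have [z xz] := gf _ cx.
exists (z + g n.+1 y); rewrite linearD -xz -gd -fy.
by rewrite subrK.
Qed.

End Homology.

(** * Tensor products and total complexes *)

Section TensorLift.
Variables (R : comNzRingType) (V W M : lmodType R) (b : V -> W -> M).
Hypotheses (bl : forall y, linear (b^~ y)) (br : forall x, linear (b x)).

Let bD x x' y : b (x + x') y = b x y + b x' y.
Proof. by have := bl y 1 x x'; rewrite !scale1r. Qed.
Let bDr x y y' : b x (y + y') = b x y + b x y'.
Proof. by have := br x 1 y y'; rewrite !scale1r. Qed.
Let bZ a x y : b (a *: x) y = a *: b x y.
Proof.
have b0 : b 0 y = 0 by apply: (addrI (b 0 y)); rewrite -bD !addr0.
by have := bl y a x 0; rewrite b0 !addr0.
Qed.
Let bZr a x y : b x (a *: y) = a *: b x y.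
Proof.
have b0 : b x 0 = 0 by apply: (addrI (b x 0)); rewrite -bDr !addr0.
by have := br x a y 0; rewrite b0 !addr0.
Qed.

Fact tens_lift_rel (u : freemod R (V * W)%type) :
  tens_rel u -> flift (fun k => b k.1 k.2) u = 0.
Proof.
by case=> [x x' y|x y y'|a x y|a x y];
  rewrite linearB ?linearD ?linearZ /tgen /= !flift_basis /= ?bD ?bDr ?bZ ?bZr
    -?opprD ?scalerN subrr.
Qed.

Definition tens_lift : tensor V W -> M :=
  qlift (flift (fun k => b k.1 k.2)) tens_lift_rel.
HB.instance Definition _ := GRing.Linear.on tens_lift.

Lemma tens_liftE x y : tens_lift (tens x y) = b x y.
Proof. by rewrite [LHS]qliftE /= flift_basis. Qed.

End TensorLift.

Section TensorMap2.
Variable R : comNzRingType.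

Lemma tens_linearl (V W : lmodType R) (y : W) :
  linear (fun x : V => tens x y).
Proof. by move=> a x x'; rewrite tensDl tensZl. Qed.

Lemma tens_linearr (V W : lmodType R) (x : V) :
  linear (fun y : W => tens x y).
Proof. by move=> a y y'; rewrite tensDr tensZr. Qed.

Definition tensl (V W : lmodType R) (y : W) : {linear V -> tensor V W} :=
  mklin (@tens_linearl V W y).
Definition tensr (V W : lmodType R) (x : V) : {linear W -> tensor V W} :=
  mklin (@tens_linearr V W x).

Lemma tens0l (V W : lmodType R) (y : W) : tens (0 : V) y = 0.
Proof. exact: (linear0 (tensl V y)). Qed.
Lemma tens0r (V W : lmodType R) (x : V) : tens x (0 : W) = 0.
Proof. exact: (linear0 (tensr W x)). Qed.
Lemma tensBl (V W : lmodType R) (x x' : V) (y : W) :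
  tens (x - x') y = tens x y - tens x' y.
Proof. exact: (linearB (tensl V y)). Qed.
Lemma tensBr (V W : lmodType R) (x : V) (y y' : W) :
  tens x (y - y') = tens x y - tens x y'.
Proof. exact: (linearB (tensr W x)). Qed.

Variables (V V' W W' : lmodType R) (f : {linear V -> V'}) (g : {linear W -> W'}).

Fact tmap2_linearl (y : W) : linear (fun x => tens (f x) (g y)).
Proof. by move=> a x x'; rewrite linearP tensDl tensZl. Qed.
Fact tmap2_linearr (x : V) : linear (fun y => tens (f x) (g y)).
Proof. by move=> a y y'; rewrite linearP tensDr tensZr. Qed.

Definition tmap2 : tensor V W -> tensor V' W' :=
  tens_lift tmap2_linearl tmap2_linearr.
HB.instance Definition _ := GRing.Linear.on tmap2.

Lemma tmap2E x y : tmap2 (tens x y) = tens (f x) (g y).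
Proof. exact: tens_liftE. Qed.

End TensorMap2.
Arguments tens_lift {R V W M b} bl br _ : simpl never.
Arguments tmap2 {R V V' W W'} f g _ : simpl never.

Lemma tmap2_comp (R : comNzRingType) (V V' V'' W W' W'' : lmodType R)
    (f : {linear V' -> V''}) (g : {linear W' -> W''})
    (f' : {linear V -> V'}) (g' : {linear W -> W'})
    (f'' : {linear V -> V''}) (g'' : {linear W -> W''}) :
  (forall x, f (f' x) = f'' x) -> (forall y, g (g' y) = g'' y) ->
  forall z, tmap2 f g (tmap2 f' g' z) = tmap2 f'' g'' z.
Proof.
move=> ff gg; apply: (tensor_ext (f := tmap2 f g \o tmap2 f' g')
  (g := tmap2 f'' g'')) => x y /=.
by rewrite !tmap2E ff gg.
Qed.

Lemma tmap2_comm (R : comNzRingType) (V V1 V2 V3 W W1 W2 W3 : lmodType R)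
    (f : {linear V1 -> V3}) (g : {linear W1 -> W3})
    (f' : {linear V -> V1}) (g' : {linear W -> W1})
    (k : {linear V2 -> V3}) (l : {linear W2 -> W3})
    (k' : {linear V -> V2}) (l' : {linear W -> W2}) :
  (forall x, f (f' x) = k (k' x)) -> (forall y, g (g' y) = l (l' y)) ->
  forall z, tmap2 f g (tmap2 f' g' z) = tmap2 k l (tmap2 k' l' z).
Proof.
move=> fk gl z; rewrite (tmap2_comp (f'' := k \o k') (g'' := l \o l'))//.
exact/esym/tmap2_comp.
Qed.

Lemma tmap2_id (R : comNzRingType) (V W : lmodType R)
    (f : {linear V -> V}) (g : {linear W -> W}) :
  (forall x, f x = x) -> (forall y, g y = y) -> forall z, tmap2 f g z = z.
Proof.
move=> ff gg; apply: (tensor_ext (f := tmap2 f g) (g := idfun)) => x y /=.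
by rewrite !tmap2E ff gg.
Qed.

Lemma tmap2_cancel (R : comNzRingType) (V V' W W' : lmodType R)
    (f : {linear V -> V'}) (g : {linear W -> W'})
    (f' : {linear V' -> V}) (g' : {linear W' -> W}) :
  (forall x, f' (f x) = x) -> (forall y, g' (g y) = y) ->
  forall z, tmap2 f' g' (tmap2 f g z) = z.
Proof.
move=> ff gg z; rewrite (tmap2_comp (f'' := idfun) (g'' := idfun))//.
exact: tmap2_id.
Qed.

Section Tot.
Variable R : pzRingType.
Implicit Types T : nat -> nat -> lmodType R.

(* The sum of the T p q over p + q + 1 = n: the total complex of a bicomplex T
   has tot T n.+1 in degree n. Peeling off the column p = 0 keeps all indices
   definitionally equal. *)
Fixpoint tot T (n : nat) : lmodType R :=
  if n is m.+1 then (T 0%N m * tot (fun p => T p.+1) m)%type else 'rV[R]_0.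

Fixpoint tot_map_fun T T' (f : forall p q, {linear T p q -> T' p q}) (n : nat) :
    tot T n -> tot T' n :=
  match n with
  | 0 => fun=> 0
  | m.+1 => fun z => (f 0%N m z.1, tot_map_fun (fun p => f p.+1) z.2)
  end.

Fact tot_map_linear T T' (f : forall p q, {linear T p q -> T' p q}) n :
  linear (@tot_map_fun T T' f n).
Proof.
elim: n T T' f => [|n IHn] T T' f a; first by move=> x y; rewrite scaler0 addr0.
by move=> [x x'] [y y'] /=; rewrite IHn linearP.
Qed.

Definition tot_map T T' (f : forall p q, {linear T p q -> T' p q}) n :
  {linear tot T n -> tot T' n} := mklin (@tot_map_linear T T' f n).

Lemma tot_map_comp T T' T'' (f : forall p q, {linear T p q -> T' p q})
    (g : forall p q, {linear T' p q -> T'' p q})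
    (h : forall p q, {linear T p q -> T'' p q}) n :
  (forall p q x, g p q (f p q x) = h p q x) ->
  forall x, tot_map g n (tot_map f n x) = tot_map h n x.
Proof.
elim: n T T' T'' f g h => [|n IHn] T T' T'' f g h fg // [x y].
rewrite /tot_map/= fg; congr pair.
apply: (IHn _ _ _ (fun p => f p.+1) (fun p => g p.+1) (fun p => h p.+1)) => p q.
exact: fg.
Qed.

Lemma tot_map_id T (f : forall p q, {linear T p q -> T p q}) n :
  (forall p q x, f p q x = x) -> forall x, tot_map f n x = x.
Proof.
elim: n T f => [|n IHn] T f fE; first by move=> x; rewrite [x]thinmx0 [LHS]thinmx0.
move=> [x y]; rewrite /tot_map/= fE; congr pair.
by apply: (IHn _ (fun p => f p.+1)) => p q; exact: fE.
Qed.

Lemma tot_map_cancel T T' (f : forall p q, {linear T p q -> T' p q})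
    (g : forall p q, {linear T' p q -> T p q}) n :
  (forall p q x, g p q (f p q x) = x) -> forall x, tot_map g n (tot_map f n x) = x.
Proof.
move=> fg x; rewrite (tot_map_comp (h := fun _ _ => idfun))//.
exact: tot_map_id.
Qed.

Lemma tot_trivial T n : (forall p q, (p + q)%N = n -> forall x : T p q, x = 0) ->
  forall x : tot T n.+1, x = 0.
Proof.
elim: n T => [|n IHn] T T0 [x y].
  by rewrite [x]T0// [y]thinmx0.
rewrite [x]T0//; congr pair.
by apply: (IHn (fun p => T p.+1)) => p q pq; apply: T0; rewrite addSn pq.
Qed.

(** No sign appears: [dh] and [dv] are to anticommute, with the sign built into [dv]. Hence the
    recursion can drop a column without tracking parity. *)
Fixpoint tot_d_fun T (dh : forall p q, {linear T p.+1 q -> T p q})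
    (dv : forall p q, {linear T p q.+1 -> T p q}) (n : nat) :
    tot T n.+1 -> tot T n :=
  match n with
  | 0 => fun=> 0
  | m.+1 => fun z => (dv 0%N m z.1 + dh 0%N m z.2.1,
      tot_d_fun (fun p => dh p.+1) (fun p => dv p.+1) z.2)
  end.

Fact tot_d_linear T (dh : forall p q, {linear T p.+1 q -> T p q})
    (dv : forall p q, {linear T p q.+1 -> T p q}) n : linear (tot_d_fun dh dv (n := n)).
Proof.
elim: n T dh dv => [|n IHn] T dh dv a; first by move=> x y; rewrite scaler0 addr0.
move=> [x [x' x'']] [y [y' y'']].
rewrite [LHS]/= [RHS]/= IHn; congr pair.
by rewrite (linearP (dv _ _)) (linearP (dh _ _)) addrACA -scalerDr.
Qed.

Definition tot_d T (dh : forall p q, {linear T p.+1 q -> T p q})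
    (dv : forall p q, {linear T p q.+1 -> T p q}) n :
  {linear tot T n.+1 -> tot T n} := mklin (tot_d_linear dh dv (n := n)).

Lemma tot_dE T (dh : forall p q, {linear T p.+1 q -> T p q})
    (dv : forall p q, {linear T p q.+1 -> T p q}) n x x' x'' :
  tot_d dh dv n.+1 (x, (x', x'')) = (dv 0%N n x + dh 0%N n x',
    tot_d (fun p => dh p.+1) (fun p => dv p.+1) n (x', x'')).
Proof. by []. Qed.

Lemma tot_dd T (dh : forall p q, {linear T p.+1 q -> T p q})
    (dv : forall p q, {linear T p q.+1 -> T p q}) n :
  (forall p q x, dh p q (dh p.+1 q x) = 0) ->
  (forall p q x, dv p q (dv p q.+1 x) = 0) ->
  (forall p q x, dv p q (dh p q.+1 x) = - dh p q (dv p.+1 q x)) ->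
  forall x, tot_d dh dv n (tot_d dh dv n.+1 x) = 0.
Proof.
elim: n T dh dv => [|n IHn] T dh dv hh vv vh // [x [x' [y z]]].
congr pair.
  by rewrite /= [X in X + _]linearD [X in _ + X]linearD /= vv hh vh add0r addr0 addNr.
by apply: (IHn _ (fun p => dh p.+1) (fun p => dv p.+1)) => p q t;
  [exact: hh|exact: vv|exact: vh].
Qed.

Lemma tot_map_d T T' (f : forall p q, {linear T p q -> T' p q})
    (dh : forall p q, {linear T p.+1 q -> T p q})
    (dv : forall p q, {linear T p q.+1 -> T p q})
    (dh' : forall p q, {linear T' p.+1 q -> T' p q})
    (dv' : forall p q, {linear T' p q.+1 -> T' p q}) n :
  (forall p q x, f p q (dh p q x) = dh' p q (f p.+1 q x)) ->
  (forall p q x, f p q (dv p q x) = dv' p q (f p q.+1 x)) ->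
  forall x, tot_map f n (tot_d dh dv n x) = tot_d dh' dv' n (tot_map f n.+1 x).
Proof.
elim: n T T' f dh dv dh' dv' => [|n IHn] T T' f dh dv dh' dv' fh fv // [x [y z]].
rewrite tot_dE; congr pair; first by rewrite /= linearD fh fv.
by apply: (IHn _ _ (fun p => f p.+1)) => p q t; [exact: fh|exact: fv].
Qed.

(** The homotopy identity in all columns but the first, stated separately so that it can be proved
    by induction. The contributions of [x] cancel because [s] anticommutes with [dv]. *)
Lemma tot_map_shift_d T (dh : forall p q, {linear T p.+1 q -> T p q})
    (dv : forall p q, {linear T p q.+1 -> T p q})
    (s : forall p q, {linear T p q -> T p.+1 q})
    (e : forall p q, {linear T p.+1 q -> T p.+1 q}) n :
  (forall p q x, dh p.+1 q (s p.+1 q x) + s p q (dh p q x) = e p q x) ->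
  (forall p q x, dv p.+1 q (s p q.+1 x) + s p q (dv p q x) = 0) ->
  forall x (y : tot (fun p => T p.+1) n),
    tot_d (fun p => dh p.+1) (fun p => dv p.+1) n
      (tot_map (T' := fun p => T p.+1) s n.+1 (x, y)) +
    tot_map (T' := fun p => T p.+1) s n (tot_d dh dv n (x, y)) = tot_map e n y.
Proof.
elim: n T dh dv s e => [|n IHn] T dh dv s e hs vs x.
  by move=> y; rewrite [LHS]thinmx0 [RHS]thinmx0.
case=> y z; rewrite tot_dE; congr pair.
  by rewrite /= [s _ _ (_ + _)]linearD addrACA vs add0r hs.
by apply: (IHn _ (fun p => dh p.+1) (fun p => dv p.+1) (fun p => s p.+1)
  (fun p => e p.+1)) => p q t; [exact: hs|exact: vs].
Qed.

Fact tot_hmap_linear T (s : forall p q, {linear T p q -> T p.+1 q}) n :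
  linear (fun z => (0, tot_map (T' := fun p => T p.+1) s n z) : tot T n.+1).
Proof.
move=> a x y; rewrite linearP; apply: (congr1 (fun u => (u, _))).
by rewrite /= scaler0 addr0.
Qed.

Definition tot_hmap T (s : forall p q, {linear T p q -> T p.+1 q}) n :
  {linear tot T n -> tot T n.+1} := mklin (@tot_hmap_linear T s n).

Lemma tot_hmap_d T (dh : forall p q, {linear T p.+1 q -> T p q})
    (dv : forall p q, {linear T p q.+1 -> T p q})
    (s : forall p q, {linear T p q -> T p.+1 q})
    (e : forall p q, {linear T p q -> T p q}) n :
  (forall q x, dh 0%N q (s 0%N q x) = e 0%N q x) ->
  (forall p q x, dh p.+1 q (s p.+1 q x) + s p q (dh p q x) = e p.+1 q x) ->
  (forall p q x, dv p.+1 q (s p q.+1 x) + s p q (dv p q x) = 0) ->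
  forall x, tot_d dh dv n.+1 (tot_hmap s n.+1 x) +
    tot_hmap s n (tot_d dh dv n x) = tot_map e n.+1 x.
Proof.
move=> hs0 hs vs [x y]; congr pair; last first.
  exact: (tot_map_shift_d (e := fun p => e p.+1) hs vs x y).
by rewrite /= linear0 add0r addr0 hs0.
Qed.

Fixpoint tot_vmap_fun T (s : forall p q, {linear T p q -> T p q.+1}) (n : nat) :
    tot T n -> tot T n.+1 :=
  match n with
  | 0 => fun=> 0
  | m.+1 => fun z => (s 0%N m z.1, tot_vmap_fun (fun p => s p.+1) z.2)
  end.

Fact tot_vmap_linear T (s : forall p q, {linear T p q -> T p q.+1}) n :
  linear (tot_vmap_fun s (n := n)).
Proof.
elim: n T s => [|n IHn] T s a; first by move=> x y; rewrite scaler0 addr0.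
move=> [x x'] [y y'].
by rewrite [LHS]/= [RHS]/= IHn linearP.
Qed.

Definition tot_vmap T (s : forall p q, {linear T p q -> T p q.+1}) n :
  {linear tot T n -> tot T n.+1} := mklin (@tot_vmap_linear T s n).

Lemma tot_vmap_d T (dh : forall p q, {linear T p.+1 q -> T p q})
    (dv : forall p q, {linear T p q.+1 -> T p q})
    (s : forall p q, {linear T p q -> T p q.+1})
    (e : forall p q, {linear T p q -> T p q}) n :
  (forall p x, dv p 0%N (s p 0%N x) = e p 0%N x) ->
  (forall p q x, dv p q.+1 (s p q.+1 x) + s p q (dv p q x) = e p q.+1 x) ->
  (forall p q x, dh p q.+1 (s p.+1 q x) + s p q (dh p q x) = 0) ->
  forall x, tot_d dh dv n.+1 (tot_vmap s n.+1 x) +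
    tot_vmap s n (tot_d dh dv n x) = tot_map e n.+1 x.
Proof.
elim: n T dh dv s e => [|n IHn] T dh dv s e vs0 vs hs [x y].
  congr pair; last by rewrite [LHS]thinmx0 [RHS]thinmx0.
  by rewrite /= linear0 !addr0 vs0.
case: y => y z; congr pair.
  by rewrite /= [s _ _ (_ + _)]linearD addrACA vs hs addr0.
by apply: (IHn _ (fun p => dh p.+1) (fun p => dv p.+1) (fun p => s p.+1)
  (fun p => e p.+1)) => [p t|p q t|p q t]; [exact: vs0|exact: vs|exact: hs].
Qed.

End Tot.

(** * The algebraic Kunneth formula *)

Lemma tot_map_sub (R : pzRingType) (T : nat -> nat -> lmodType R)
    (f g : forall p q, {linear T p q -> T p q}) n :
  (forall p q x, f p q x = x - g p q x) ->
  forall x, tot_map f n x = x - tot_map g n x.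
Proof.
elim: n T f g => [|n IHn] T f g fg.
  by move=> x; rewrite [LHS]thinmx0 [RHS]thinmx0.
move=> [x y]; congr pair; first exact: fg.
by apply: (IHn _ (fun p => f p.+1) (fun p => g p.+1)) => p q; exact: fg.
Qed.

Lemma tot_d0 (R : pzRingType) (T : nat -> nat -> lmodType R) n x :
  tot_d (T := T) (fun _ _ => \0) (fun _ _ => \0) n x = 0.
Proof.
elim: n T x => [|n IHn] T; first by [].
move=> [x [y z]]; congr pair; first by rewrite /= addr0.
exact: (IHn (fun p => T p.+1)).
Qed.

Section TensorComplex.
Variables (R : comNzRingType) (C D : complex R).

Definition tens_obj p q : lmodType R := tensor (C p) (D q).

Definition tens_dh p q : {linear tens_obj p.+1 q -> tens_obj p q} :=
  tmap2 (cpx_d C p) idfun.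

Definition tens_dv p q : {linear tens_obj p q.+1 -> tens_obj p q} :=
  tmap2 idfun ((-1) ^+ p \*: cpx_d D q).

Lemma tens_dhh p q x : tens_dh p q (tens_dh p.+1 q x) = 0.
Proof.
apply: (tensor_ext (f := tens_dh p q \o tens_dh p.+1 q) (g := \0)) => y z /=.
by rewrite !tmap2E cpx_dd tens0l.
Qed.

Lemma tens_dvv p q x : tens_dv p q (tens_dv p q.+1 x) = 0.
Proof.
apply: (tensor_ext (f := tens_dv p q \o tens_dv p q.+1) (g := \0)) => y z /=.
by rewrite !tmap2E /= linearZ /= cpx_dd !scaler0 tens0r.
Qed.

Lemma tens_dvh p q x :
  tens_dv p q (tens_dh p q.+1 x) = - tens_dh p q (tens_dv p.+1 q x).
Proof.
apply: (tensor_ext (f := tens_dv p q \o tens_dh p q.+1)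
  (g := \- (tens_dh p q \o tens_dv p.+1 q))) => y z /=.
rewrite !tmap2E /= !tensZr exprS mulN1r.
by rewrite scaleNr opprK.
Qed.

Lemma tens_cpx_dd n x :
  tot_d tens_dh tens_dv n.+1 (tot_d tens_dh tens_dv n.+2 x) = 0.
Proof.
by apply: tot_dd; [exact: tens_dhh|exact: tens_dvv|exact: tens_dvh].
Qed.

Definition tens_cpx : complex R :=
  @Complex R (fun n => tot tens_obj n.+1) (fun n => tot_d tens_dh tens_dv n.+1)
    tens_cpx_dd.

(** In degree 0 the map [tot_d] goes to the zero space, so one equation describes the cycles in
    every degree. *)
Lemma tens_cpx_cycle n (x : tens_cpx n) :
  cpx_cycle x <-> tot_d tens_dh tens_dv n x = 0.
Proof. by case: n x. Qed.

End TensorComplex.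

Section Kunneth.
Variables (F : fieldType) (C D : complex F) (HC HD : nat -> lmodType F).
Variables (rC : forall n, {linear C n -> HC n}) (iC : forall n, {linear HC n -> C n})
  (sC : forall n, {linear C n -> C n.+1}).
Variables (rD : forall n, {linear D n -> HD n}) (iD : forall n, {linear HD n -> D n})
  (sD : forall n, {linear D n -> D n.+1}).
Hypotheses (splC : splitting rC iC sC) (splD : splitting rD iD sD).

Let T := tens_obj C D.
Let d n : {linear tot T n.+1 -> tot T n} := tot_d (tens_dh C D) (tens_dv C D) n.

Definition kunneth_proj n : {linear tens_cpx C D n ->
    tot (fun p q => tensor (HC p) (HD q)) n.+1} :=
  tot_map (fun p q => tmap2 (rC p) (rD q)) n.+1.

Let iota n : {linear tot (fun p q => tensor (HC p) (HD q)) n.+1 -> tot T n.+1} :=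
  tot_map (fun p q => tmap2 (iC p) (iD q)) n.+1.

Let eh p q : {linear T p q -> T p q} := tmap2 (iC p \o rC p) idfun.
Let ev p q : {linear T p q -> T p q} := tmap2 idfun (iD q \o rD q).
Let sh p q : {linear T p q -> T p.+1 q} := tmap2 (sC p) idfun.
(** The sign repeats that of the vertical differential: the two multiply to 1 in the homotopy
    identity, and [sv] anticommutes with the horizontal differential. *)
Let sv p q : {linear T p q -> T p q.+1} := tmap2 idfun ((-1) ^+ p \*: sD q).

(* Contract C onto its homology, then D onto its homology. *)
Let homotopy_h n x : x - tot_map eh n.+1 x =
  d n.+1 (tot_hmap sh n.+1 x) + tot_hmap sh n (d n x).
Proof.
have [_ _ _ s0 sS] := splC.
pose e p q : {linear T p q -> T p q} := tmap2 (idfun \- (iC p \o rC p)) idfun.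
rewrite -(tot_map_sub (f := e)); last first.
  move=> p q y; apply: (tensor_ext (f := e p q) (g := idfun \- eh p q)) => u v /=.
  by rewrite !tmap2E /= tensBl.
rewrite (tot_hmap_d (e := e))// => [q y|p q y|p q y].
- apply: (tensor_ext (f := tens_dh C D 0 q \o sh 0%N q) (g := e 0%N q)) => u v /=.
  by rewrite !tmap2E /= s0.
- apply: (tensor_ext (f := (tens_dh C D p.+1 q \o sh p.+1 q) \+
    (sh p q \o tens_dh C D p q)) (g := e p.+1 q)) => u v /=.
  by rewrite !tmap2E /= sS tensDl.
- apply: (tensor_ext (f := (tens_dv C D p.+1 q \o sh p q.+1) \+
    (sh p q \o tens_dv C D p q)) (g := \0)) => u v /=.
  rewrite !tmap2E /= !tensZr exprS mulN1r scaleNr.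
  by rewrite addNr.
Qed.

Let homotopy_v n x : x - tot_map ev n.+1 x =
  d n.+1 (tot_vmap sv n.+1 x) + tot_vmap sv n (d n x).
Proof.
have [_ _ _ s0 sS] := splD.
pose e p q : {linear T p q -> T p q} := tmap2 idfun (idfun \- (iD q \o rD q)).
rewrite -(tot_map_sub (f := e)); last first.
  move=> p q y; apply: (tensor_ext (f := e p q) (g := idfun \- ev p q)) => u v /=.
  by rewrite !tmap2E /= tensBr.
rewrite (tot_vmap_d (e := e))// => [p y|p q y|p q y].
- apply: (tensor_ext (f := tens_dv C D p 0 \o sv p 0) (g := e p 0%N)) => u v /=.
  rewrite !tmap2E /= s0 linearZ /= scalerA.
  by rewrite -expr2 sqrr_sign scale1r.
- apply: (tensor_ext (f := (tens_dv C D p q.+1 \o sv p q.+1) \+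
    (sv p q \o tens_dv C D p q)) (g := e p q.+1)) => u v /=.
  rewrite !tmap2E /= sS !linearZ /= !scalerA.
  by rewrite -expr2 sqrr_sign !scale1r tensDr.
- apply: (tensor_ext (f := (tens_dh C D p q.+1 \o sv p.+1 q) \+
    (sv p q \o tens_dh C D p q)) (g := \0)) => u v /=.
  rewrite !tmap2E /= !tensZr exprS mulN1r scaleNr.
  by rewrite addNr.
Qed.

Let iota_proj n x : tot_map ev n.+1 (tot_map eh n.+1 x) = iota n (kunneth_proj n x).
Proof.
pose f p q : {linear T p q -> T p q} := tmap2 (iC p \o rC p) (iD q \o rD q).
rewrite (tot_map_comp (h := f)); last by move=> p q y; exact: tmap2_comp.
by rewrite /iota /kunneth_proj (tot_map_comp (h := f))// => p q y; exact: tmap2_comp.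
Qed.

Lemma kunneth_computes n : computes (kunneth_proj n).
Proof.
have [riC rdC diC _ _] := splC; have [riD rdD diD _ _] := splD.
have projd m x : kunneth_proj m (d m.+1 x) = 0.
  rewrite /kunneth_proj /d (tot_map_d (dh' := fun _ _ => \0) (dv' := fun _ _ => \0)).
  - by rewrite tot_d0.
  - move=> p q y; apply: (tensor_ext (f := tmap2 (rC p) (rD q) \o tens_dh C D p q)
      (g := \0)) => u v /=.
    by rewrite !tmap2E /= rdC tens0l.
  - move=> p q y; apply: (tensor_ext (f := tmap2 (rC p) (rD q) \o tens_dv C D p q)
      (g := \0)) => u v /=.
    by rewrite !tmap2E /= linearZ /= rdD scaler0 tens0r.
have diota x : d n (iota n x) = 0.
  rewrite /iota /d -(tot_map_d (dh := fun _ _ => \0) (dv := fun _ _ => \0)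
    (f := fun p q => tmap2 (iC p) (iD q))).
  - by rewrite tot_d0 linear0.
  - move=> p q y; apply: (tensor_ext (g := tens_dh C D p q \o tmap2 (iC p.+1) (iD q))
      (f := tmap2 (iC p) (iD q) \o \0)) => u v /=.
    by rewrite /tens_dh linear0 !tmap2E /= diC tens0l.
  - move=> p q y; apply: (tensor_ext (g := tens_dv C D p q \o tmap2 (iC p) (iD q.+1))
      (f := tmap2 (iC p) (iD q) \o \0)) => u v /=.
    by rewrite /tens_dv linear0 !tmap2E /= diD scaler0 tens0r.
split=> [h|x /tens_cpx_cycle cx].
  exists (iota n h); first exact/tens_cpx_cycle/diota.
  rewrite /iota /kunneth_proj.
  apply: tot_map_cancel => p q; apply: tmap2_cancel; [exact: riC|exact: riD].
split=> [x0|[y ->]]; last exact: projd.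
have dx : d n x = 0 by [].
(* The cycle [x] is bounded in two stages: [x - y] by the horizontal homotopy, and [y] by the
   vertical one, since [tot_map ev] sends [y] to [iota] of the projection of [x], which is 0. *)
pose y := tot_map eh n.+1 x.
have xy := homotopy_h x; rewrite dx linear0 addr0 -/y in xy.
have dy : d n y = 0.
  have -> : y = x - (x - y) by rewrite opprB addrC subrK.
  rewrite linearB dx xy.
  rewrite [d n _](_ : _ = 0) ?subr0//.
  apply: tot_dd; [exact: tens_dhh|exact: tens_dvv|exact: tens_dvh].
have := homotopy_v y; rewrite dy linear0 addr0 iota_proj x0 linear0 subr0 => yE.
exists (tot_hmap sh n.+1 x + tot_vmap sv n.+1 y).
change (x = d n.+1 (tot_hmap sh n.+1 x + tot_vmap sv n.+1 y)).
by rewrite linearD -xy -yE subrK.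
Qed.

End Kunneth.

(** * Vanishing of Tor over a field *)

Section Tor.
Variable F : fieldType.

(** A cycle is an element of the next syzygy, and the basis vector it indexes evaluates to it. *)
Lemma freeres_exact (R : comNzRingType) (V : lmodType R) n (u : freeres V n.+1) :
  cpx_d (freeres V) n u = 0 -> exists v, u = cpx_d (freeres V) n.+1 v.
Proof.
move=> u0; have ku : u \in ker_pred (@feval _ (syzygy V n.+1)).
  by apply/eqP/val_inj.
exists (fbasis _ (Ker ku : syzygy V n.+2)).
exact/esym/(congr1 val (flift_basis id (Ker ku : syzygy V n.+2))).
Qed.

(** Exactness at [U1] yields an identity [s1 d1 + d2 t = 1], which any additive functor
    preserves. *)
Lemma tmap_exact (U2 U1 U0 W : lmodType F) (d2 : {linear U2 -> U1})
    (d1 : {linear U1 -> U0}) :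
  (forall u, d1 u = 0 -> exists v, u = d2 v) ->
  forall z, tmap W d1 z = 0 -> exists y, z = tmap W d2 y.
Proof.
move=> ex.
have [s1 s1P] := generalized_inverse d1.
have [s2 s2P] := generalized_inverse d2.
have xE u : s1 (d1 u) + d2 (s2 (u - s1 (d1 u))) = u.
  have [|v uv] := ex (u - s1 (d1 u)); first by rewrite linearB s1P subrr.
  by rewrite uv s2P -uv addrC subrK.
pose t : {linear U1 -> U2} := s2 \o (idfun \- (s1 \o d1)).
have zE z : tmap W s1 (tmap W d1 z) + tmap W d2 (tmap W t z) = z.
  apply: (tensor_ext (f := (tmap W s1 \o tmap W d1) \+ (tmap W d2 \o tmap W t))
    (g := idfun)) => u w /=.
  by rewrite !tmapE -tensDl xE.
by move=> z z0; exists (tmap W t z); rewrite -[LHS]zE z0 linear0 add0r.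
Qed.

Lemma Tor1_trivial (V W : lmodType F) (x : Tor 1 V W) : x = 0.
Proof.
rewrite -[x]qreprK; apply/qproj0P/Defs.sub_span.
exact: (tmap_exact (@freeres_exact _ V 0%N) (eqP (valP (qrepr x)))).
Qed.

End Tor.

(** * Reindexing total complexes as direct sums *)

Section DirectSums.
Variable R : pzRingType.
Implicit Types V : nat -> lmodType R.

Definition pair_lin (A B A' B' : lmodType R) (f : A -> A') (g : B -> B')
  (x : A * B) : A' * B' := (f x.1, g x.2).

Lemma pair_lin_linear (A B A' B' : lmodType R) (f : {linear A -> A'})
  (g : {linear B -> B'}) : linear (pair_lin f g : A * B -> A' * B').
Proof. by move=> a [x y] [x' y']; rewrite /pair_lin /= !linearP. Qed.

Lemma pair_lin_bijective (A B A' B' : Type) (f : A -> A') (g : B -> B') :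
  bijective f -> bijective g ->
  bijective (fun x : A * B => (f x.1, g x.2)).
Proof.
move=> [f' fK Kf] [g' gK Kg]; exists (fun x => (f' x.1, g' x.2)) => -[x y] /=.
  by rewrite fK gK.
by rewrite Kf Kg.
Qed.

(** [dsum] splits off its last summand and [tot] its first; this reconciles the two recursions. *)
Lemma dsum_recl V n : exists f : {linear (V 0%N * dsum (fun p => V p.+1) n)%type ->
  dsum V n.+1}, bijective f.
Proof.
elim: n => [|n [f f_bij]].
  have Lf : linear (fun x : V 0%N * 'rV[R]_0 => (x.2, x.1) : 'rV[R]_0 * V 0%N).
    by [].
  by exists (mklin Lf); exists (fun x => (x.2, x.1)) => -[].
have Lf : linear (fun x : V 0%N * dsum (fun p => V p.+1) n.+1 =>
    (f (x.1, x.2.1), x.2.2) : dsum V n.+2).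
  move=> a [x [y z]] [x' [y' z']]; congr pair.
  exact: (linearP f a (x, y) (x', y')).
exists (mklin Lf).
have [g fK gK] := f_bij.
exists (fun x : dsum V n.+1 * V n.+1 => ((g x.1).1, ((g x.1).2, x.2))) => -[x y] /=.
  by case: y => y z /=; rewrite fK.
by rewrite -[((g x).1, (g x).2)]surjective_pairing gK.
Qed.

Lemma tot_dsum (T : nat -> nat -> lmodType R) n :
  exists f : {linear tot T n.+1 -> dsum (fun p => T p (n - p)%N) n.+1}, bijective f.
Proof.
elim: n T => [|n IHn] T.
  have Lf : linear (fun x : tot T 1 => (x.2, x.1) : 'rV[R]_0 * T 0%N 0%N).
    by [].
  by exists (mklin Lf); exists (fun x => (x.2, x.1)) => -[].
have [f f_bij] := IHn (fun p => T p.+1).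
(* [n.+1 - p.+1] converts to [n - p], so [g] composes with the inductive map without any cast. *)
have [g g_bij] := dsum_recl (fun p => T p (n.+1 - p)%N) n.+1.
pose h : {linear tot T n.+2 ->
    (T 0%N n.+1 * dsum (fun p => T p.+1 (n - p)%N) n.+1)%type}
  := mklin (pair_lin_linear (idfun : {linear T 0%N n.+1 -> T 0%N n.+1}) f).
exists (g \o h); apply: bij_comp => //.
by apply: pair_lin_bijective => //; exists id.
Qed.

Lemma dsum_trivial V n : (forall p (x : V p), x = 0) -> forall x : dsum V n, x = 0.
Proof.
move=> V0; elim: n => [|n IHn] x; first exact: thinmx0.
by case: x => x y; rewrite [x]IHn [y]V0.
Qed.

End DirectSums.

(** * Discrete modules *)

Section Submodule.
Variables (R : pzRingType) (V : lmodType R) (Q : set V).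

(** The proof is an argument of the predicate so that the closure instance can be attached to it. *)
Definition subm_pred of is_submod Q : {pred V} := [pred x | `[< Q x >]].

Hypothesis Qs : is_submod Q.

Fact subm_closed : GRing.submod_closed (subm_pred Qs).
Proof.
split=> [|a x y /asboolP Qx /asboolP Qy]; apply/asboolP; first exact: Qs.1.
exact: Qs.2.
Qed.
HB.instance Definition _ :=
  GRing.isSubmodClosed.Build R V (subm_pred Qs) subm_closed.

Record subm : Type := Subm { subm_val : V; _ : subm_val \in subm_pred Qs }.
HB.instance Definition _ := [isSub for subm_val].
HB.instance Definition _ := [Choice of subm by <:].
HB.instance Definition _ := [SubChoice_isSubLmodule of subm by <:].

Lemma submP (x : subm) : Q (val x).
Proof. exact/asboolP/(valP x). Qed.

Definition to_subm (x : V) (Qx : Q x) : subm :=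
  Subm (introT (asboolP _) Qx : x \in subm_pred Qs).

Variables (U : lmodType R) (f : {linear U -> V}).

Fact subm_corestr_linear (fQ : forall u, Q (f u)) :
  linear (fun u => to_subm (fQ u)).
Proof. by move=> a x y; apply: val_inj; rewrite /= linearP. Qed.

Definition subm_corestr (fQ : forall u, Q (f u)) : {linear U -> subm} :=
  mklin (subm_corestr_linear fQ).

End Submodule.

Lemma quotmod_submod (R : pzRingType) (V : lmodType R) (Q : set V) (x : V) :
  is_submod Q -> qproj Q x = 0 -> Q x.
Proof. by move=> Qs /qproj0P/Defs.spanP; apply. Qed.

Lemma tensor_submod (R : comNzRingType) (V W : lmodType R) (Q : set (tensor V W)) :
  is_submod Q -> (forall x y, Q (tens x y)) -> forall z, Q z.
Proof.
move=> Qs Qt z; apply: quotmod_submod => //.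
apply: (tensor_ext (f := qproj Q) (g := \0)) => x y /=.
exact/qproj0P/Defs.sub_span.
Qed.

Section DiscreteModuleConstructions.
Variable G : topologicalGroupType.

(** Near a stabilising [g], write [h] as [g * (g^-1 * h)], whose second factor is close to 1. *)
Lemma stab_open (X : Type) (act : G -> X -> X) (x : X) :
  (forall y, act 1%g y = y) ->
  (forall g h y, act (g * h)%g y = act g (act h y)) ->
  nbhs (1%g : G) [set g | act g x = x] -> open [set g | act g x = x].
Proof.
move=> act1 actM nx; rewrite openE => g /= gx.
rewrite -[1%g](mulVg g) in nx.
have ng := @mulgl_continuous G g^-1%g g _ nx.
apply: (@filterS _ (nbhs g) _ _ _ _ ng) => h /= hx.
by rewrite -[h](mulVKg g) actM hx.
Qed.

Lemma dm_stab_nbhs (A : discMod G) (x : A) :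
  nbhs (1%g : G) [set g | dm_act A g x = x].
Proof.
by apply: open_nbhs_nbhs; split; [exact: dm_stab_open|exact: dm_act1].
Qed.

Lemma dm_actK (A : discMod G) g : cancel (dm_act A g) (dm_act A g^-1%g).
Proof. by move=> x; rewrite -dm_actM mulVg dm_act1. Qed.

Definition dh_id (A : discMod G) : discHom A A :=
  @DiscHom _ A A idfun (fun _ _ => erefl).

Fact dh_comp_act (A B C : discMod G) (f : discHom B C) (g : discHom A B) h x :
  f (g (dm_act A h x)) = dm_act C h (f (g x)).
Proof. by rewrite !dh_act. Qed.

Definition dh_comp (A B C : discMod G) (f : discHom B C) (g : discHom A B) :
  discHom A C := @DiscHom _ A C (f \o g) (dh_comp_act f g).

Fact dh_sub_act (A B : discMod G) (f g : discHom A B) h x :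
  (f \- g) (dm_act A h x) = dm_act B h ((f \- g) x).
Proof. by rewrite /= !dh_act linearB. Qed.

Definition dh_sub (A B : discMod G) (f g : discHom A B) : discHom A B :=
  @DiscHom _ A B (f \- g) (dh_sub_act f g).

Section Sub.
Variables (V : lmodType rat) (act : G -> {linear V -> V}).
Hypotheses (act1 : forall x, act 1%g x = x)
  (actM : forall g h x, act (g * h)%g x = act g (act h x)).
Variables (Q : set V) (Qs : is_submod Q).
Hypotheses (Qact : forall g x, Q x -> Q (act g x))
  (Qsm : forall x, Q x -> nbhs (1%g : G) [set g | act g x = x]).

Fact sub_act_stable g (x : subm Qs) : Q ((act g \o val) x).
Proof. exact: (Qact g (submP x)). Qed.

Definition sub_act g : {linear subm Qs -> subm Qs} :=
  subm_corestr Qs (sub_act_stable g).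

Fact sub_act1 x : sub_act 1%g x = x.
Proof. by apply: val_inj; rewrite /= act1. Qed.
Fact sub_actM g h x : sub_act (g * h)%g x = sub_act g (sub_act h x).
Proof. by apply: val_inj; rewrite /= actM. Qed.
Fact sub_act_open x : open [set g | sub_act g x = x].
Proof.
apply: (stab_open (act := fun g => sub_act g)); [exact: sub_act1|exact: sub_actM|].
by apply: filterS (Qsm (submP x)) => g gx; apply: val_inj.
Qed.

(** Open stabilisers are asked on [Q] only, so a discrete module can be cut out of an action that is
    not discrete, such as the one on all functions [P -> X]. *)
Definition sub_dm : discMod G :=
  @DiscMod G (subm Qs) sub_act sub_act1 sub_actM sub_act_open.

End Sub.

(** Projectivity speaks of surjections; [a] becomes one when corestricted to the discrete submodule
    [ker b]. *)
Lemma projective_exact (P A B C : discMod G) (a : discHom A B) (b : discHom B C)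
    (f : discHom P B) : dm_projective P ->
  (forall x, b x = 0 <-> exists y, a y = x) -> (forall x, b (f x) = 0) ->
  exists h : discHom P A, forall x, a (h x) = f x.
Proof.
move=> Pp ab bf; pose Q := [set x | b x = 0].
have Qs : is_submod Q.
  split=> [|c x y]; first exact: linear0.
  by rewrite /Q/= linearP => -> ->; rewrite scaler0 addr0.
have Qact g x : Q x -> Q (dm_act B g x) by rewrite /Q/= dh_act => ->; exact: linear0.
pose K := sub_dm (@dm_act1 _ B) (@dm_actM _ B) Qs Qact
  (fun x _ => @dm_stab_nbhs B x).
have aQ x : Q (a x) by apply/ab; exists x.
have a_act g x : (subm_corestr Qs aQ) (dm_act A g x) =
    dm_act K g (subm_corestr Qs aQ x).
  by apply: val_inj; rewrite /= dh_act.
have f_act g x : (subm_corestr Qs bf) (dm_act P g x) =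
    dm_act K g (subm_corestr Qs bf x).
  by apply: val_inj; rewrite /= dh_act.
pose a' := @DiscHom _ A K (subm_corestr Qs aQ) a_act.
pose f' := @DiscHom _ P K (subm_corestr Qs bf) f_act.
have [b'|h hP] := Pp A K a' f'.
  by have /ab[y yb] := submP b'; exists y; exact: val_inj.
by exists h => x; have := congr1 val (hP x).
Qed.

(** The orbit map is locally constant because the stabiliser of [a] is open. Near-covering
    compactness is used with the filter of all sufficiently large finite sets. *)
Lemma compact_orbit_finite (A : discMod G) (C : set G) (a : A) : compact C ->
  exists D : {fset A}, forall c, C c -> dm_act A c a \in D.
Proof.
move=> /compact_near_coveringP cC.
pose Fl := filter_from [set: {fset A}] (fun E => [set D | (E `<=` D)%fset]).
have FF : Filter Fl.
  apply: filter_from_filter; first by exists fset0.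
  move=> E E' _ _; exists (E `|` E')%fset => // D /= ED.
  by split; apply: fsubset_trans ED; [exact: fsubsetUl|exact: fsubsetUr].
have [c Cc|D _ DP] := cC {fset A} Fl (fun D c => dm_act A c a \in D).
  exists ([set c' | dm_act A (c^-1 * c')%g a = a], [set D | dm_act A c a \in D]).
    split=> /=; last by exists [fset dm_act A c a]%fset => // D /= /fsubsetP; apply;
      rewrite inE.
    have nc := dm_stab_nbhs a; rewrite -[1%g](mulVg c) in nc.
    exact: (@mulgl_continuous G c^-1%g c _ nc).
  by move=> [c' D] /= [cc cD]; rewrite -[c'](mulVKg c) dm_actM cc.
by exists D => c Cc; apply: (DP D) => //=.
Qed.

(* The K-orbit of a0 is finite, hence has an average. *)
Lemma average_lift (A B : discMod G) (p : discHom A B) (K C : set G) (a0 : A) :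
  K 1%g -> (forall x y, K x -> K y -> K (x * y)%g) -> (forall x, K x -> K x^-1%g) ->
  K `<=` C -> compact C -> (forall k, K k -> dm_act B k (p a0) = p a0) ->
  exists2 a, (forall k, K k -> dm_act A k a = a) & p a = p a0.
Proof.
move=> K1 KM KV KC /(compact_orbit_finite a0)[D CD] pK.
pose O := undup [seq x <- D | `[< exists2 k, K k & x = dm_act A k a0 >]].
have OP x : reflect (exists2 k, K k & x = dm_act A k a0) (x \in O).
  rewrite mem_undup mem_filter; apply: (iffP andP) => [[/asboolP //]|[k Kk xk]].
  by split; [apply/asboolP; exists k|rewrite xk; exact/CD/KC].
have perm k : K k -> perm_eq (map (dm_act A k) O) O.
  move=> Kk; apply: uniq_perm; last move=> x.
  - rewrite map_inj_uniq ?undup_uniq//; exact: can_inj (@dm_actK A k).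
  - exact: undup_uniq.
  apply/mapP/OP => [[y /OP[l Kl ->] ->]|[l Kl ->]].
    by exists (k * l)%g; [exact: KM|rewrite dm_actM].
  exists (dm_act A (k^-1 * l)%g a0); last by rewrite -dm_actM mulVKg.
  by apply/OP; exists (k^-1 * l)%g => //; apply: KM => //; exact: KV.
(* The average divides by the orbit size, which is invertible in [rat] because [a0] belongs to the
   orbit. *)
have O0 : (size O)%:R != 0 :> rat.
  rewrite pnatr_eq0 size_eq0; apply: contraTneq isT => O0.
  have : a0 \in O by apply/OP; exists 1%g => //; rewrite dm_act1.
  by rewrite O0.
exists ((size O)%:R^-1 *: \sum_(x <- O) x).
  move=> k Kk; rewrite linearZ linear_sum /=; congr (_ *: _).
  by rewrite -[RHS](perm_big _ (perm k Kk)) /= big_map.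
rewrite linearZ linear_sum /= (eq_big_seq (fun=> p a0)); last first.
  by move=> x /OP[k Kk ->] /=; rewrite dh_act (pK _ Kk).
by rewrite big_const_seq count_predT iter_addr_0 -scaler_nat scalerA mulVf// scale1r.
Qed.

End DiscreteModuleConstructions.

Section Restriction.
Variables (G G' : topologicalGroupType) (j : G -> G').
Hypotheses (jc : continuous j) (j1 : j 1%g = 1%g)
  (jM : forall x y, j (x * y)%g = (j x * j y)%g).
Variable A : discMod G'.

Fact res_act1 x : dm_act A (j 1%g) x = x.
Proof. by rewrite j1 dm_act1. Qed.
Fact res_actM g h x : dm_act A (j (g * h)%g) x = dm_act A (j g) (dm_act A (j h) x).
Proof. by rewrite jM dm_actM. Qed.
Fact res_act_open x : open [set g | dm_act A (j g) x = x].
Proof. by move/continuousP: jc => /(_ _ (@dm_stab_open _ A x)). Qed.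

Definition res_dm : discMod G :=
  @DiscMod G A (fun g => dm_act A (j g)) res_act1 res_actM res_act_open.

End Restriction.

Section TensorModule.
Variables (G H : topologicalGroupType) (P : discMod G) (P' : discMod H).

Definition tens_act (g : G * H) : {linear tensor P P' -> tensor P P'} :=
  tmap2 (dm_act P g.1) (dm_act P' g.2).

Fact tens_act1 x : tens_act 1%g x = x.
Proof. by apply: tmap2_id => y; exact: dm_act1. Qed.
Fact tens_actM g h x : tens_act (g * h)%g x = tens_act g (tens_act h x).
Proof. by apply/esym/tmap2_comp => y; rewrite dm_actM. Qed.

(** The vectors fixed near 1 form a submodule, and a pure tensor is fixed by the product of two
    stabilisers. *)
Fact tens_act_nbhs x : nbhs (1%g : G * H) [set g | tens_act g x = x].
Proof.
apply: (tensor_submod (Q := fun x => nbhs (1%g : G * H) [set g | tens_act g x = x])).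
  split=> [|a y z ny nz].
    by apply: filterS filterT => g _; exact: linear0.
  by apply: filterS (filterI ny nz) => g [gy gz] /=; rewrite linearP gy gz.
move=> y z.
exists ([set g | dm_act P g y = y], [set g | dm_act P' g z = z]).
  by split; exact: dm_stab_nbhs.
by move=> [g h] /= [gy hz]; rewrite tmap2E gy hz.
Qed.

Fact tens_act_open x : open [set g | tens_act g x = x].
Proof.
by apply: (stab_open (act := tens_act) tens_act1 tens_actM); exact: tens_act_nbhs.
Qed.

Definition tens_dm : discMod (G * H)%type :=
  @DiscMod _ (tensor P P') tens_act tens_act1 tens_actM tens_act_open.

End TensorModule.

Section SmoothHom.
Variables (G H : topologicalGroupType) (P : discMod H) (X : discMod (G * H)%type).

(** The neighbourhood of 1 in the last clause is uniform in [x], so that a single compact open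
    subgroup will fix all values of [f]. *)
Definition smooth_hom : set (P -> X) := [set f | [/\ linear f,
  forall h x, f (dm_act P h x) = dm_act X (1%g, h) (f x) &
  nbhs (1%g : G) [set g | forall x, dm_act X (g, 1%g) (f x) = f x]]].

Fact smooth_hom_submod : is_submod smooth_hom.
Proof.
split=> [|a f f' [fL fH fG] [fL' fH' fG']].
  split=> [a x y|h x|]; first by rewrite /= scaler0 addr0.
    by rewrite linear0.
  by apply: filterS filterT => g _ x; rewrite linear0.
have E z : (a *: f + f') z = a *: f z + f' z by [].
split=> [b x y|h x|]; rewrite ?E.
- rewrite fL fL' !scalerDr !scalerA addrACA.
  by rewrite [a * b]mulrC.
- by rewrite linearP fH fH'.
- by apply: filterS (filterI fG fG') => g [fg fg'] x; rewrite E linearP fg fg'.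
Qed.

Fact hom_act_linear (g : G) :
  linear (fun (f : P -> X) x => dm_act X (g, 1%g) (f x)).
Proof. by move=> a f f'; apply/funext => x; rewrite /= linearP. Qed.

Definition hom_act (g : G) : {linear (P -> X) -> (P -> X)} :=
  mklin (hom_act_linear g).

Fact hom_act1 f : hom_act 1%g f = f.
Proof. by apply/funext => x; exact: dm_act1. Qed.

Fact hom_actM g h f : hom_act (g * h)%g f = hom_act g (hom_act h f).
Proof.
apply/funext => x; rewrite /= -dm_actM; congr (dm_act X _ _).
by congr pair; rewrite mulg1.
Qed.

Fact hom_act_stable g f : smooth_hom f -> smooth_hom (hom_act g f).
Proof.
move=> [fL fH fG]; split.
- by move=> a x y; rewrite /= fL linearP.
- move=> h x; rewrite /= fH -!dm_actM; congr (dm_act X _ _).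
  by congr pair; rewrite ?mulg1 ?mul1g.
(* The stabiliser of the translate by [g] is a conjugate of that of [f], and conjugation is
   continuous. *)
- have nG : nbhs (g^-1 * 1 * g)%g [set k | forall x, dm_act X (k, 1%g) (f x) = f x].
    by rewrite mulg1 mulVg.
  have c1 := @mulgl_continuous G g^-1%g 1%g _ (@mulgr_continuous G g _ _ nG).
  apply: (@filterS _ (nbhs (1%g : G)) _ _ _ _ c1) => k /= kf x.
  rewrite -[in RHS](kf x) -!dm_actM; congr (dm_act X _ _).
  by congr pair; rewrite ?mulg1// mulgA mulgA mulgV mul1g.
Qed.

Fact hom_act_nbhs f : smooth_hom f -> nbhs (1%g : G) [set g | hom_act g f = f].
Proof. by move=> [_ _]; apply: filterS => g gf; exact/funext. Qed.

Definition smooth_hom_dm : discMod G :=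
  sub_dm hom_act1 hom_actM smooth_hom_submod hom_act_stable hom_act_nbhs.

End SmoothHom.

(** * Projectivity and comparison of resolutions *)

Section TensorProjective.
Variables G H : topologicalGroupType.

Let inl (g : G) : (G * H)%type := (g, 1%g).
Let inr (h : H) : (G * H)%type := (1%g, h).

Let inlc : continuous inl.
Proof. by move=> g; apply: cvg_pair => /=; [exact: cvg_id|exact: cvg_cst]. Qed.
Let inrc : continuous inr.
Proof. by move=> g; apply: cvg_pair => /=; [exact: cvg_cst|exact: cvg_id]. Qed.
Let inlM x y : inl (x * y)%g = (inl x * inl y)%g.
Proof. by congr pair; rewrite mulg1. Qed.
Let inrM x y : inr (x * y)%g = (inr x * inr y)%g.
Proof. by congr pair; rewrite mulg1. Qed.
Let inlr x y : (inl x * inr y)%g = (inr y * inl x)%g.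
Proof. by congr pair; rewrite ?mulg1 ?mul1g. Qed.

Let resl (A : discMod (G * H)%type) := res_dm inlc erefl inlM A.
Let resr (A : discMod (G * H)%type) := res_dm inrc erefl inrM A.

Definition fixed_by (K : set G) (A : discMod (G * H)%type) : set A :=
  [set a | forall k, K k -> dm_act A (inl k) a = a].

Fact fixed_by_submod K A : is_submod (@fixed_by K A).
Proof.
split=> [k _|a x y fx fy k Kk]; first exact: linear0.
by rewrite linearP fx// fy.
Qed.

Fact fixed_by_stable K A h x :
  @fixed_by K A x -> @fixed_by K A (dm_act (resr A) h x).
Proof.
by move=> fx k Kk; rewrite /= -dm_actM inlr dm_actM fx.
Qed.

Definition fixed_dm K A : discMod H :=
  sub_dm (@dm_act1 _ (resr A)) (@dm_actM _ (resr A)) (@fixed_by_submod K A)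
    (@fixed_by_stable K A) (fun x _ => @dm_stab_nbhs _ (resr A) x).

(* If K is a compact open subgroup fixing the values of f, then averaging over K
   makes p surjective on K-fixed vectors, and f lifts there as P' is projective. *)
Lemma smooth_hom_lift (P' : discMod H) (A B : discMod (G * H)%type)
    (p : discHom A B) (f : P' -> B) :
  tdlc G -> dm_projective P' -> (forall b, exists a, p a = b) ->
  smooth_hom f -> exists2 f', smooth_hom f' & forall x, p (f' x) = f x.
Proof.
move=> tG P'p ps [fL fH /(compact_open_subgroup tG)].
move=> [K [C [K1 KM KV nK [KC CU cC]]]].
have fK x : fixed_by K (f x) by move=> k /KC/CU.
have pK a : fixed_by K a -> fixed_by K (p a).
  by move=> aK k Kk; rewrite -dh_act aK.
have pK' (a : fixed_dm K A) : fixed_by K ((p \o val) a) by exact: (pK _ (submP a)).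
have p_act h (a : fixed_dm K A) :
    subm_corestr (@fixed_by_submod K B) pK' (dm_act _ h a) =
    dm_act (fixed_dm K B) h (subm_corestr (@fixed_by_submod K B) pK' a).
  by apply: val_inj; exact: dh_act.
pose p' := @DiscHom _ (fixed_dm K A) (fixed_dm K B) _ p_act.
have f_act h x : subm_corestr (@fixed_by_submod K B) (f := mklin fL) fK
    (dm_act P' h x) = dm_act (fixed_dm K B) h
    (subm_corestr (@fixed_by_submod K B) (f := mklin fL) fK x).
  by apply: val_inj; rewrite /= fH.
pose f' := @DiscHom _ P' (fixed_dm K B) _ f_act.
have [b|g gP] := P'p _ _ p' f'.
  have pl_act g x : p (dm_act (resl A) g x) = dm_act (resl B) g (p x).
    exact: dh_act.
  pose pl := @DiscHom _ (resl A) (resl B) p pl_act.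
  have [a0 pa0] := ps (val b).
  have [|a aK pa] := @average_lift _ _ _ pl K C a0 K1 KM KV KC cC.
    by move=> k Kk; rewrite /= pa0; exact: (submP b).
  by exists (to_subm (@fixed_by_submod K A) aK); apply: val_inj; rewrite /= -pa0 -pa.
exists (val \o g); last by move=> x; exact: (congr1 val (gP x)).
split=> [a x y|h x|]; first by rewrite /= linearP.
  by rewrite /= dh_act.
by apply: filterS nK => k Kk x; exact: (submP (g x)).
Qed.

(* Maps P (x) P' -> A correspond to maps from P to the smooth vectors of
   Hom_H(P', A). *)
Lemma tens_dm_projective (P : discMod G) (P' : discMod H) :
  tdlc G -> dm_projective P -> dm_projective P' -> dm_projective (tens_dm P P').
Proof.
move=> tG Pp P'p A B p f ps.
pose EA := smooth_hom_dm P' A; pose EB := smooth_hom_dm P' B.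
have cL : linear (fun (u : P' -> A) x => p (u x)).
  by move=> a u v; apply/funext => x; rewrite linearP.
have cS (u : EA) : smooth_hom ((mklin cL \o val) u).
  have [uL uH uG] := submP u.
  split=> [a x y|h x|]; first by rewrite /= uL linearP.
    by rewrite /= uH dh_act.
  by apply: filterS uG => g ug x; rewrite /= -dh_act ug.
have c_act g (u : EA) : subm_corestr (smooth_hom_submod P' B) cS (dm_act EA g u) =
    dm_act EB g (subm_corestr (smooth_hom_submod P' B) cS u).
  by apply: val_inj; apply/funext => x; rewrite /= dh_act.
pose c := @DiscHom _ EA EB _ c_act.
have f_tens g h x y :
    f (tens (dm_act P g x) (dm_act P' h y)) = dm_act B (g, h) (f (tens x y)).
  by rewrite -dh_act /= tmap2E.
have fL : linear (fun x : P => (fun y => f (tens x y)) : P' -> B).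
  by move=> a x x'; apply/funext => y; rewrite tens_linearl linearP.
have fS x : smooth_hom (mklin fL x).
  split=> [a y y'|h y|]; first by rewrite /= tens_linearr linearP.
    by rewrite -(f_tens 1%g) dm_act1.
  apply: filterS (dm_stab_nbhs x) => g gx y.
  by rewrite -[LHS]f_tens gx dm_act1.
have f_act g x : subm_corestr (smooth_hom_submod P' B) fS (dm_act P g x) =
    dm_act EB g (subm_corestr (smooth_hom_submod P' B) fS x).
  by apply: val_inj; apply/funext => y; rewrite /= -f_tens dm_act1.
pose f' := @DiscHom _ P EB _ f_act.
(* Projectivity of [P] lifts the curried map [f'] through composition with [p], which is surjective
   on smooth maps by projectivity of [P']. Uncurrying [k] gives the lift of [f]. *)
have [b|k kP] := Pp _ _ c f'.
  have [u uS up] := smooth_hom_lift tG P'p ps (submP b).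
  exists (to_subm (smooth_hom_submod P' A) uS); apply: val_inj; apply/funext => x.
  exact: up.
pose b x y := val (k x) y.
have bl y : linear (b^~ y) by move=> a x x'; rewrite /b linearP.
have br x : linear (b x) by case: (submP (k x)).
have h_act g z : tens_lift bl br (dm_act (tens_dm P P') g z) =
    dm_act A g (tens_lift bl br z).
  case: g => g h.
  apply: (tensor_ext (f := tens_lift bl br \o dm_act (tens_dm P P') (g, h))
    (g := dm_act A (g, h) \o tens_lift bl br)) => x y /=.
  rewrite tmap2E !tens_liftE /b dh_act /=.
  have [_ kH _] := submP (k x).
  rewrite kH -dm_actM; congr (dm_act A _ _).
  by congr pair; rewrite ?mulg1 ?mul1g.
exists (@DiscHom _ (tens_dm P P') A _ h_act).
apply: (tensor_ext (f := p \o tens_lift bl br) (g := f)) => x y /=.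
rewrite tens_liftE /b.
by have := congr1 (fun u : EB => val u y) (kP x).
Qed.

End TensorProjective.

Section TotModule.
Variable G : topologicalGroupType.
Implicit Types T : nat -> nat -> discMod G.

Definition tot_act T n (g : G) :
    {linear tot (fun p q => T p q : lmodType rat) n -> tot (fun p q => T p q) n} :=
  tot_map (fun p q => dm_act (T p q) g) n.

Fact tot_act1 T n x : tot_act T n 1%g x = x.
Proof. by apply: tot_map_id => p q y; exact: dm_act1. Qed.
Fact tot_actM T n g h x : tot_act T n (g * h)%g x = tot_act T n g (tot_act T n h x).
Proof. by apply/esym/tot_map_comp => p q y; rewrite dm_actM. Qed.

Fact tot_act_nbhs T n x : nbhs (1%g : G) [set g | tot_act T n g x = x].
Proof.
elim: n T x => [|n IHn] T.
  by move=> x; apply: filterS filterT => g _ /=; rewrite [LHS]thinmx0 [RHS]thinmx0.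
move=> [x y]; apply: filterS (filterI (dm_stab_nbhs x) (IHn (fun p => T p.+1) y)).
by move=> g [gx gy]; congr pair.
Qed.

Fact tot_act_open T n x : open [set g | tot_act T n g x = x].
Proof.
apply: (stab_open (act := fun g => tot_act T n g)); last exact: tot_act_nbhs.
  exact: tot_act1.
exact: tot_actM.
Qed.

Definition tot_dm T n : discMod G :=
  @DiscMod _ _ (tot_act T n) (@tot_act1 T n) (@tot_actM T n) (@tot_act_open T n).

Lemma tot_dm_projective T n :
  (forall p q, dm_projective (T p q)) -> dm_projective (tot_dm T n).
Proof.
elim: n T => [|n IHn] T Tp A B p f ps.
  have h_act g (x : tot_dm T 0%N) : (\0 : {linear tot_dm T 0%N -> A})
    (dm_act (tot_dm T 0%N) g x) = dm_act A g ((\0 : {linear tot_dm T 0%N -> A}) x).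
    by rewrite /= linear0.
  exists (DiscHom h_act) => x; rewrite /= linear0.
  by rewrite [x]thinmx0 (linear0 f).
pose T1 := fun p => T p.+1.
have Ll : linear (fun x => (x, 0) : tot_dm T n.+1).
  by move=> a x y; congr pair; rewrite /= scaler0 addr0.
have Lr : linear (fun y => (0, y) : tot_dm T n.+1).
  by move=> a x y; congr pair; rewrite /= scaler0 addr0.
have l_act g x : (f \o mklin Ll) (dm_act (T 0%N n) g x) =
    dm_act B g ((f \o mklin Ll) x).
  apply: etrans (dh_act f g ((x, 0) : tot_dm T n.+1)); apply: (congr1 f).
  by congr pair; exact/esym/(linear0 (tot_act T1 n g)).
have r_act g x : (f \o mklin Lr) (dm_act (tot_dm T1 n) g x) =
    dm_act B g ((f \o mklin Lr) x).
  apply: etrans (dh_act f g ((0, x) : tot_dm T n.+1)); apply: (congr1 f).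
  by congr pair; exact/esym/(linear0 (dm_act (T 0%N n) g)).
have [hl hlP] := Tp 0 n A B p (@DiscHom _ (T 0%N n) B _ l_act) ps.
have [hr hrP] :=
  IHn T1 (fun p => Tp p.+1) A B p (@DiscHom _ (tot_dm T1 n) B _ r_act) ps.
have Lh : linear (fun z : tot_dm T n.+1 => hl z.1 + hr z.2).
  by move=> a [x x'] [y y'] /=; rewrite !linearP scalerDr addrACA.
have h_act g z : mklin Lh (dm_act (tot_dm T n.+1) g z) = dm_act A g (mklin Lh z).
  case: z => x y; rewrite [RHS](linearD (dm_act A g)).
  exact: (congr2 +%R (dh_act hl g x) (dh_act hr g y)).
exists (@DiscHom _ (tot_dm T n.+1) A _ h_act) => -[x y].
rewrite /= linearD hlP hrP /= -linearD; congr (f _).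
by congr pair; rewrite /= ?addr0 ?add0r.
Qed.

End TotModule.

Lemma nat_dependent_choice (X : nat -> Type) (good : forall n, X n -> Prop)
    (R : forall n, X n -> X n.+1 -> Prop) :
  (exists x, good 0%N x) ->
  (forall n x, good n x -> exists2 y, good n.+1 y & R n x y) ->
  exists f : forall n, X n, good 0%N (f 0%N) /\ forall n, R n (f n) (f n.+1).
Proof.
move=> /cid[x0 g0] step.
pose next n (x : {x | good n x}) : {y | good n.+1 y /\ R n (projT1 x) y} :=
  let: exist2 y gy Ry := cid2 (step n (projT1 x) (projT2 x)) in exist _ y (conj gy Ry).
pose fix F n : {x | good n x} :=
  match n with
  | 0 => exist _ x0 g0
  | m.+1 => exist _ (projT1 (next m (F m))) (projT2 (next m (F m))).1
  end.
exists (fun n => projT1 (F n)); split=> // n.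
exact: (projT2 (next n (F n))).2.
Qed.

Section Comparison.
Variables (G : topologicalGroupType) (N : discMod G) (P Q : projRes N).

Lemma pr_dd (R : projRes N) n x : pr_d R n (pr_d R n.+1 x) = 0.
Proof. by apply/(@pr_exactS _ _ R); exists x. Qed.

Lemma pr_aug_d (R : projRes N) x : pr_aug R (pr_d R 0 x) = 0.
Proof. by apply/(@pr_exact0 _ _ R); exists x. Qed.

Definition chain_map (f : forall n, discHom (P n) (Q n)) :=
  (forall x, pr_aug Q (f 0%N x) = pr_aug P x) /\
  forall n x, pr_d Q n (f n.+1 x) = f n (pr_d P n x).

Lemma chain_map_exists : exists f, chain_map f.
Proof.
(* Preserving cycles is what the next lift requires, and unlike compatibility with the differentials
   it involves a single map. *)
pose good n : discHom (P n) (Q n) -> Prop :=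
  match n with
  | 0 => fun f => forall x, pr_aug Q (f x) = pr_aug P x
  | m.+1 => fun f => forall x, pr_d P m x = 0 -> pr_d Q m (f x) = 0
  end.
have good0 : exists f, good 0%N f.
  exact: (@pr_proj _ _ P 0 _ _ (pr_aug Q) (pr_aug P) (@pr_aug_surj _ _ Q)).
have goodS n (f : discHom (P n) (Q n)) : good n f -> exists2 f', good n.+1 f' &
    forall x, pr_d Q n (f' x) = f (pr_d P n x).
  move=> gf.
  have [f' f'P] : exists f' : discHom (P n.+1) (Q n.+1),
      forall x, pr_d Q n (f' x) = dh_comp f (pr_d P n) x.
    case: n f gf => [|n] f gf.
      apply: (projective_exact (@pr_proj _ _ P 1) (@pr_exact0 _ _ Q)) => x.
      by rewrite /= gf pr_aug_d.
    apply: (projective_exact (@pr_proj _ _ P n.+2) (@pr_exactS _ _ Q n)) => x.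
    by rewrite /= gf// pr_dd.
  by exists f' => //= x dx; rewrite f'P /= dx linear0.
have [f [f0 fS]] := nat_dependent_choice good0 goodS.
by exists f.
Qed.

Lemma chain_homotopy (u v : forall n, discHom (P n) (Q n)) :
  chain_map u -> chain_map v -> exists h : forall n, discHom (P n) (Q n.+1),
    (forall x, u 0%N x - v 0%N x = pr_d Q 0 (h 0%N x)) /\
    forall n x, u n.+1 x - v n.+1 x = pr_d Q n.+1 (h n.+1 x) + h n (pr_d P n x).
Proof.
move=> [u0 uS] [v0 vS].
pose w n := dh_sub (u n) (v n).
(* This is the homotopy identity on boundaries, where its term from the previous degree vanishes, so
   that only one [h] occurs. *)
pose good n : discHom (P n) (Q n.+1) -> Prop :=
  match n with
  | 0 => fun h => forall x, w 0%N x = pr_d Q 0 (h x)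
  | m.+1 => fun h => forall x, w m.+1 (pr_d P m.+1 x) = pr_d Q m.+1 (h (pr_d P m.+1 x))
  end.
have gd n h : good n h -> forall x, w n (pr_d P n x) = pr_d Q n (h (pr_d P n x)).
  by case: n h.
have good0 : exists h, good 0%N h.
  have [|h hP] := projective_exact (@pr_proj _ _ P 0) (@pr_exact0 _ _ Q) (f := w 0%N).
    by move=> x; rewrite /= linearB u0 v0 subrr.
  by exists h => x; rewrite hP.
have goodS n (h : discHom (P n) (Q n.+1)) : good n h -> exists2 h', good n.+1 h' &
    forall x, w n.+1 x = pr_d Q n.+1 (h' x) + h (pr_d P n x).
  move=> /gd gh.
  have [|h' h'P] := projective_exact (@pr_proj _ _ P n.+1) (@pr_exactS _ _ Q n)
      (f := dh_sub (w n.+1) (dh_comp h (pr_d P n))).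
    by move=> x; rewrite /= !linearB uS vS -gh /= subrr.
  exists h' => [x|x]; last by rewrite h'P /= subrK.
  by rewrite h'P /= pr_dd linear0 subr0.
have [h [h0 hS]] := nat_dependent_choice good0 goodS.
by exists h; split.
Qed.

End Comparison.

(** * The tensor product of two resolutions *)

Section Resolution.
Variables (G H : topologicalGroupType) (tG : tdlc G).
Variables (PG : projRes (trivQ G)) (PH : projRes (trivQ H)).

Definition pr_cpx (K : topologicalGroupType) (N : discMod K) (P : projRes N) :
  complex rat := @Complex rat (fun n => P n) (fun n => pr_d P n) (@pr_dd _ _ P).

Definition point_homology (n : nat) : lmodType rat :=
  if n is 0 then rat^o else 'rV[rat]_0.

Definition pr_aug_cpx (K : topologicalGroupType) (P : projRes (trivQ K)) n :
    {linear pr_cpx P n -> point_homology n} :=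
  match n with 0 => pr_aug P | m.+1 => \0 end.

Lemma pr_aug_computes (K : topologicalGroupType) (P : projRes (trivQ K)) n :
  computes (pr_aug_cpx P n).
Proof.
case: n => [|n]; split.
- by move=> h; have [x <-] := @pr_aug_surj _ _ P h; exists x.
- by move=> x _; rewrite (@pr_exact0 _ _ P); split=> -[y yx]; exists y.
- by move=> h; exists 0; [exact: linear0|rewrite [LHS]thinmx0 [RHS]thinmx0].
- by move=> x /= /(@pr_exactS _ _ P)[y yx]; split=> // _; exists y.
Qed.

Let C := pr_cpx PG.
Let D := pr_cpx PH.
Let T p q := tens_dm (PG p) (PH q).

Fact tens_res_act n g x :
  tot_d (tens_dh C D) (tens_dv C D) n.+1 (dm_act (tot_dm T n.+2) g x) =
  dm_act (tot_dm T n.+1) g (tot_d (tens_dh C D) (tens_dv C D) n.+1 x).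
Proof.
apply/esym/tot_map_d => p q y; apply: tmap2_comm => z //=.
- by rewrite dh_act.
- by rewrite dh_act linearZ.
Qed.

Definition tens_res_d n : discHom (tot_dm T n.+2) (tot_dm T n.+1) :=
  @DiscHom _ (tot_dm T n.+2) (tot_dm T n.+1)
    (tot_d (tens_dh C D) (tens_dv C D) n.+1) (@tens_res_act n).

Definition rat_mul (x y : rat^o) : rat^o := x * y.
Fact rat_mul_linearl y : linear (rat_mul^~ y).
Proof. by move=> a x x'; rewrite /rat_mul mulrDl -scalerAl. Qed.
Fact rat_mul_linearr x : linear (rat_mul x).
Proof. by move=> a y y'; rewrite /rat_mul mulrDr -scalerAr. Qed.

Definition mul_tens : {linear tensor rat^o rat^o -> rat^o} :=
  tens_lift rat_mul_linearl rat_mul_linearr.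

Lemma mul_tensE x y : mul_tens (tens x y) = x * y.
Proof. exact: tens_liftE. Qed.

(** Every tensor is its product times the tensor of 1 with 1. *)
Lemma mul_tens_inj z : mul_tens z = 0 -> z = 0.
Proof.
have one_lin : linear (fun a : rat^o => a *: tens (1 : rat^o) (1 : rat^o)).
  by move=> a x y; rewrite scalerDl scalerA.
have zE : z = mklin one_lin (mul_tens z).
  apply: (tensor_ext (f := idfun) (g := mklin one_lin \o mul_tens)) => x y /=.
  rewrite -[x in LHS]mulr1 -[y in LHS]mulr1 mul_tensE.
  by rewrite (tensZl x (1 : rat^o)) (tensZr y _ (1 : rat^o)) scalerA.
by move=> z0; rewrite zE z0 linear0.
Qed.

Definition tens_res_aug_fun : {linear tot_dm T 1 -> rat^o} :=
  mul_tens \o (tmap2 (pr_aug PG) (pr_aug PH) \o fst).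

Fact tens_res_aug_act g x :
  tens_res_aug_fun (dm_act (tot_dm T 1) g x) = tens_res_aug_fun x.
Proof.
have augE z : tmap2 (pr_aug PG) (pr_aug PH) (tens_act _ _ g z) =
    tmap2 (pr_aug PG) (pr_aug PH) z.
  by apply: tmap2_comp => y; exact: dh_act.
by case: x => x y; exact: (congr1 mul_tens (augE x)).
Qed.

Definition tens_res_aug : discHom (tot_dm T 1) (trivQ (G * H)%type) :=
  @DiscHom _ (tot_dm T 1) (trivQ (G * H)%type) tens_res_aug_fun tens_res_aug_act.

(** In degree 0 every element is a cycle, so the retractions [rC] and [rD] are the augmentations
    there. The kernel of [phi 0] is then that of [tens_res_aug], multiplication being injective. *)
Lemma tens_res_exact : exists phi : forall n,
    {linear tens_cpx C D n ->
      tot (fun p q => tensor (point_homology p) (point_homology q)) n.+1},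
  (forall n, computes (phi n)) /\
  forall x, tens_res_aug x = 0 <-> phi 0%N x = 0.
Proof.
have [rC [iC [sC [splC rCE]]]] := computes_splitting (@pr_aug_computes _ PG).
have [rD [iD [sD [splD rDE]]]] := computes_splitting (@pr_aug_computes _ PH).
exists (fun n => kunneth_proj rC rD n); split=> [n|[x y]].
  exact (kunneth_computes splC splD n).
have rx : tmap2 (rC 0%N) (rD 0%N) x = tmap2 (pr_aug PG) (pr_aug PH) x.
  apply: (tensor_ext (f := tmap2 (rC 0%N) (rD 0%N))
    (g := tmap2 (pr_aug PG) (pr_aug PH))) => u v.
  apply: etrans (tmap2E _ _ u v) _; apply: etrans _ (esym (tmap2E _ _ u v)).
  exact: (congr2 (@tens _ _ _) (rCE 0%N u I) (rDE 0%N v I)).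
split=> [h|/(congr1 fst) x0].
  have x0 : tmap2 (pr_aug PG) (pr_aug PH) x = 0 by exact: mul_tens_inj h.
  by congr pair; apply: etrans rx x0.
have {}x0 : tmap2 (pr_aug PG) (pr_aug PH) x = 0 by rewrite -rx.
by apply: etrans (congr1 mul_tens x0) _; exact: linear0.
Qed.

Lemma tens_trivial (R : comNzRingType) (V W : lmodType R) :
  (forall x : V, x = 0) \/ (forall y : W, y = 0) -> forall z : tensor V W, z = 0.
Proof.
move=> VW; apply: (tensor_ext (f := idfun) (g := \0)) => x y /=.
by case: VW => VW; [rewrite [x]VW tens0l|rewrite [y]VW tens0r].
Qed.

Fact tens_res_proj n : dm_projective (tot_dm T n.+1).
Proof.
by apply: tot_dm_projective => p q; apply: tens_dm_projective => //; exact: pr_proj.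
Qed.

Fact tens_res_aug_surj m : exists x, tens_res_aug x = m.
Proof.
have [x xm] := @pr_aug_surj _ _ PG m; have [y y1] := @pr_aug_surj _ _ PH 1.
exists (tens x y, 0).
by rewrite /tens_res_aug /tens_res_aug_fun /= tmap2E xm y1 mul_tensE mulr1.
Qed.

Fact tens_res_exact0 x : tens_res_aug x = 0 <-> exists y, tens_res_d 0 y = x.
Proof.
have [phi [phiP augP]] := tens_res_exact.
rewrite augP (phiP 0%N).2//.
by split=> -[y yx]; exists y.
Qed.

Fact tens_res_exactS n x :
  tens_res_d n x = 0 <-> exists y, tens_res_d n.+1 y = x.
Proof.
have [phi [phiP _]] := tens_res_exact.
split=> [dx|[y <-]]; last exact: (@cpx_dd _ (tens_cpx C D)).
have [|+ _] := (phiP n.+1).2 x; first exact: dx.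
case=> [|y xy]; last by exists y.
(* In positive total degree [p] or [q] is positive, so each summand of the target has a zero factor
   and [phi] kills [x]. *)
apply: tot_trivial => p q pq; apply: tens_trivial.
case: p q pq => [|p] q pq; last by left => y; rewrite [LHS]thinmx0 [RHS]thinmx0.
by right; case: q pq => // q _ y; rewrite [LHS]thinmx0 [RHS]thinmx0.
Qed.

Definition tens_res : projRes (trivQ (G * H)%type) :=
  @ProjRes _ _ (fun n => tot_dm T n.+1) tens_res_d tens_res_aug tens_res_proj
    tens_res_aug_surj tens_res_exact0 tens_res_exactS.

End Resolution.

(** * Coinvariants *)

Arguments gtmap {G P Q} M f _ : simpl never.

Lemma gtensor_ext (G : topologicalGroupType) (P M : discMod G) (W : lmodType rat)
    (f g : {linear gtensor P M -> W}) :
  (forall x m, f (qproj _ (tens x m)) = g (qproj _ (tens x m))) -> f =1 g.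
Proof.
move=> fg; apply: quotmod_ext => z.
exact: (tensor_ext (f := f \o qproj _) (g := g \o qproj _)).
Qed.

Lemma gtmap_tens (G : topologicalGroupType) (P Q M : discMod G) (f : discHom P Q) x m :
  gtmap M f (qproj _ (tens x m)) = qproj _ (tens (f x) m).
Proof. by rewrite gtmapE tmapE. Qed.

(** Comparison maps in both directions are homotopy inverse to each other, and tensoring with [M]
    over [G] preserves the homotopies. *)
Lemma computes_resolution (G : topologicalGroupType) (N M : discMod G)
    (P Q : projRes N) n (W : lmodType rat)
    (phi : {linear pr_gtensor M P n -> W}) : computes phi ->
  exists psi : {linear pr_gtensor M Q n -> W}, computes psi.
Proof.
have [u cu] := chain_map_exists Q P; have [v cv] := chain_map_exists P Q.
have homotopic (A B : projRes N) (f : forall n, discHom (A n) (B n))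
    (g : forall n, discHom (B n) (A n)) m : chain_map f -> chain_map g ->
  forall x : pr_gtensor M A m, cpx_cycle x ->
    exists y, x - gtmap M (g m) (gtmap M (f m) x) = cpx_d (pr_gtensor M A) m y.
  move=> [f0 fS] [g0 gS] x cx.
  have idc : chain_map (fun n => dh_id (A n)) by [].
  have gfc : chain_map (fun n => dh_comp (g n) (f n)).
    by split=> [y|k y] /=; rewrite ?g0 ?gS ?f0 ?fS.
  have [h [h0 hS]] := chain_homotopy idc gfc.
  case: m x cx => [|k] x cx.
    exists (gtmap M (h 0%N) x).
    apply: (gtensor_ext
      (f := idfun \- (gtmap M (g 0%N) \o gtmap M (f 0%N)))
      (g := gtmap M (pr_d A 0) \o gtmap M (h 0%N))) => y m /=.
    by rewrite !gtmap_tens -linearB -tensBl h0.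
  (* On a cycle the second homotopy term is 0. Adding it gives an identity valid for all elements,
     which can be tested on pure tensors. *)
  exists (gtmap M (h k.+1) x); rewrite -[RHS]addr0.
  rewrite -(linear0 (gtmap M (h k))) -cx.
  apply: (gtensor_ext
    (f := idfun \- (gtmap M (g k.+1) \o gtmap M (f k.+1)))
    (g := (gtmap M (pr_d A k.+1) \o gtmap M (h k.+1)) \+
          (gtmap M (h k) \o gtmap M (pr_d A k)))) => y m /=.
  by rewrite !gtmap_tens -linearB -tensBl hS tensDl linearD.
move=> phiP.
exists (phi \o (gtmap M (u n) : {linear pr_gtensor M Q n -> pr_gtensor M P n})).
apply: (computes_transport (C := pr_gtensor M P) (D := pr_gtensor M Q)
  (f := fun n => gtmap M (u n)) (g := fun n => gtmap M (v n))) => //.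
- move=> k; apply: (gtensor_ext (f := gtmap M (u k) \o gtmap M (pr_d Q k))
    (g := gtmap M (pr_d P k) \o gtmap M (u k.+1))) => x m /=.
  by rewrite !gtmap_tens cu.2.
- move=> k; apply: (gtensor_ext (f := gtmap M (v k) \o gtmap M (pr_d P k))
    (g := gtmap M (pr_d Q k) \o gtmap M (v k.+1))) => x m /=.
  by rewrite !gtmap_tens cv.2.
- exact: homotopic.
- exact: homotopic.
Qed.

Section Coinvariants.
Variable G : topologicalGroupType.
Implicit Types X : discMod G.

Definition coinv X : {linear X -> gtensor X (trivQ G)} :=
  qproj (@gtens_rel G X (trivQ G)) \o tensl X (1 : rat^o).

Lemma coinvE X (x : X) (a : rat^o) :
  qproj (@gtens_rel G X (trivQ G)) (tens x a) = a *: coinv X x.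
Proof. by rewrite /= -linearZ -tensZr /GRing.scale/= mulr1. Qed.

Lemma coinv_act X g x : coinv X (dm_act X g x) = coinv X x.
Proof.
(* The right action is through inverses, so the relation is taken at [g^-1]. *)
by apply: qproj_rel; rewrite /=; exists g^-1%g, x, (1 : rat^o); rewrite invgK.
Qed.

Lemma coinv_ext X (W : lmodType rat) (f g : {linear gtensor X (trivQ G) -> W}) :
  (forall x, f (coinv X x) = g (coinv X x)) -> f =1 g.
Proof. by move=> fg; apply: gtensor_ext => x m; rewrite coinvE !linearZ fg. Qed.

Lemma coinv_surj X u : exists x, coinv X x = u.
Proof.
rewrite -[u]qreprK; move: (qrepr u); apply: tensor_submod.
  split=> [|a y z [x xy] [x' xz]]; first by exists 0; rewrite !linear0.
  by exists (a *: x + x'); rewrite !linearP xy xz.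
by move=> x a; exists (a *: x); rewrite linearZ coinvE.
Qed.

Section Lift.
Variables (X : discMod G) (W : lmodType rat) (psi : {linear X -> W}).
Hypothesis psi_act : forall g x, psi (dm_act X g x) = psi x.

Let b (x : X) (a : rat^o) : W := a *: psi x.
Fact coinv_lift_linearl a : linear (b^~ a).
Proof. by move=> c x x'; rewrite /b linearP scalerDr !scalerA mulrC. Qed.
Fact coinv_lift_linearr x : linear (b x).
Proof. by move=> c a a'; rewrite /b scalerDl scalerA. Qed.

Fact coinv_lift_rel z : @gtens_rel G X (trivQ G) z ->
  tens_lift coinv_lift_linearl coinv_lift_linearr z = 0.
Proof.
by move=> [g [x [a ->]]]; rewrite linearB /= !tens_liftE /b psi_act subrr.
Qed.

Definition coinv_lift : {linear gtensor X (trivQ G) -> W} :=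
  qlift (tens_lift coinv_lift_linearl coinv_lift_linearr) coinv_lift_rel.

Lemma coinv_liftE x : coinv_lift (coinv X x) = psi x.
Proof.
apply: etrans (qliftE coinv_lift_rel _) _; rewrite /= tens_liftE /b.
exact: scale1r.
Qed.

(** Meant for [psi] the class map of a larger module restricted to one summand or one tensor slot:
    equalities of classes are carried over from there. *)
Lemma coinv_kernel x y : coinv X x = coinv X y -> psi x = psi y.
Proof. by move=> xy; rewrite -!coinv_liftE xy. Qed.

End Lift.

(* The last condition says that the kernel of pi is spanned by the g x - x. *)
Definition coinvariants X (Y : lmodType rat) (pi : {linear X -> Y})
    (t : {linear Y -> X}) :=
  [/\ forall y, pi (t y) = y, forall g x, pi (dm_act X g x) = pi x &
      forall x, coinv X (t (pi x)) = coinv X x].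

Lemma coinvariants_exists X : exists t, coinvariants (coinv X) t.
Proof.
have [|t tP] := @linear_lift _ _ _ _ (coinv X)
    (idfun : {linear gtensor X (trivQ G) -> _}).
  exact: coinv_surj.
by exists t; split=> [|g x|x]; [exact: tP|exact: coinv_act|exact: tP].
Qed.

Lemma coinvariants_tot (T : nat -> nat -> discMod G) (Y : nat -> nat -> lmodType rat)
    (pi : forall p q, {linear T p q -> Y p q}) (t : forall p q, {linear Y p q -> T p q})
    n : (forall p q, coinvariants (pi p q) (t p q)) ->
  coinvariants (X := tot_dm T n) (tot_map pi n) (tot_map t n).
Proof.
elim: n T Y pi t => [|n IHn] T Y pi t pt.
  split=> [y|g x|x]; first by rewrite [LHS]thinmx0 [RHS]thinmx0.
    by rewrite [LHS]thinmx0 [RHS]thinmx0.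
  by congr (coinv _ _); rewrite [LHS]thinmx0 [RHS]thinmx0.
have IH := IHn (fun p => T p.+1) (fun p => Y p.+1) (fun p => pi p.+1)
  (fun p => t p.+1) (fun p => pt p.+1).
have [i1 i2 i3] := IH; have [p1 p2 p3] := pt 0%N n.
split.
- by move=> [x y]; congr pair; [exact: p1|exact: i1].
- by move=> g [x y]; congr pair; [exact: p2|exact: i2].
move=> [x y].
pose c := coinv (tot_dm T n.+1).
have Ll : linear (fun x => (x, 0) : tot_dm T n.+1).
  by move=> a u v; congr pair; rewrite /= scaler0 addr0.
have Lr : linear (fun y => (0, y) : tot_dm T n.+1).
  by move=> a u v; congr pair; rewrite /= scaler0 addr0.
have pairE u v : c (u, v) = (c \o mklin Ll) u + (c \o mklin Lr) v.
  apply: etrans (linearD c (u, 0) (0, v)); apply: (congr1 c).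
  by congr pair; rewrite /= ?addr0 ?add0r.
have l_act g u : (c \o mklin Ll) (dm_act (T 0%N n) g u) = (c \o mklin Ll) u.
  rewrite -[RHS](coinv_act g); apply: (congr1 c).
  by congr pair; exact/esym/(linear0 (tot_act (fun p => T p.+1) n g)).
have r_act g u : (c \o mklin Lr) (dm_act (tot_dm (fun p => T p.+1) n) g u) =
    (c \o mklin Lr) u.
  rewrite -[RHS](coinv_act g); apply: (congr1 c).
  by congr pair; exact/esym/(linear0 (dm_act (T 0%N n) g)).
apply: etrans (pairE (t 0%N n (pi 0%N n x))
  (tot_map (fun p => t p.+1) n (tot_map (fun p => pi p.+1) n y))) _.
apply: etrans (congr2 +%R (coinv_kernel l_act (p3 x)) (coinv_kernel r_act (i3 y))) _.
exact/esym/pairE.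
Qed.

End Coinvariants.

(** One slot is replaced at a time: the action of [G] gives [x] for [t (pi x)] with the right slot
    held fixed, and then that of [H] gives [x'] for [t' (pi' x')]. *)
Lemma coinvariants_tens (G H : topologicalGroupType) (X : discMod G) (X' : discMod H)
    (Y Y' : lmodType rat) (pi : {linear X -> Y}) (t : {linear Y -> X})
    (pi' : {linear X' -> Y'}) (t' : {linear Y' -> X'}) :
  coinvariants pi t -> coinvariants pi' t' ->
  coinvariants (X := tens_dm X X') (tmap2 pi pi') (tmap2 t t').
Proof.
move=> [p1 p2 p3] [p1' p2' p3']; split.
- exact: tmap2_cancel.
- by move=> g z; apply: tmap2_comp => x; [exact: p2|exact: p2'].
pose c : {linear tensor X X' -> gtensor (tens_dm X X') (trivQ _)} :=
  coinv (tens_dm X X').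
pose e : {linear tensor X X' -> tensor X X'} := tmap2 t t' \o tmap2 pi pi'.
suff ce x x' : (c \o e) (tens x x') = c (tens x x').
  have ceE := tensor_ext ce.
  by move=> z; exact (ceE z).
have eE : e (tens x x') = tens (t (pi x)) (t' (pi' x')) by rewrite /e /= !tmap2E.
apply: etrans (congr1 c eE) _ => {eE}.
have l_act w g u : (c \o tensl X w) (dm_act X g u) = (c \o tensl X w) u.
  rewrite -[RHS](coinv_act (g, 1%g)); apply: (congr1 c).
  by rewrite /= tmap2E dm_act1.
have r_act w g u : (c \o tensr X' w) (dm_act X' g u) = (c \o tensr X' w) u.
  rewrite -[RHS](coinv_act (1%g, g)); apply: (congr1 c).
  by rewrite /= tmap2E dm_act1.
apply: etrans (coinv_kernel (r_act x) (p3' x')).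
exact: (coinv_kernel (l_act (t' (pi' x'))) (p3 x)).
Qed.

Lemma bijective_pair_trivial (R : pzRingType) (U V W Z : lmodType R)
    (f : {linear U -> V}) (g : {linear V -> W}) :
  bijective f -> bijective g -> (forall z : Z, z = 0) ->
  exists h : {linear U -> (W * Z)%type}, bijective h.
Proof.
move=> [f' fK f'K] [g' gK g'K] Z0.
have L : linear (fun x => (g (f x), 0) : W * Z).
  move=> a x y; rewrite !linearP; congr pair.
  by rewrite /= scaler0 addr0.
exists (mklin L); exists (fun x => f' (g' x.1)) => [x|[x z]] /=.
  by rewrite gK fK.
by rewrite f'K g'K (Z0 z).
Qed.

Theorem theorem2p22 (G H : topologicalGroupType)
    (hG : tdlc G) (hH : tdlc H)
    (PG : projRes (trivQ G)) (PH : projRes (trivQ H))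
    (PGH : projRes (trivQ (G * H)%type)) (n : nat) :
  exists f : {linear dH PGH n (trivQ (G * H)%type) ->
      (dsum (fun p : nat => tensor (dH PG p (trivQ G)) (dH PH (n - p)%N (trivQ H)))
          n.+1
       * dsum (fun p : nat =>
            Tor 1 (dH PG p (trivQ G)) (dH PH (n - 1 - p)%N (trivQ H))) n)%type},
    bijective f.
Proof.
pose C := pr_gtensor (trivQ G) PG; pose D := pr_gtensor (trivQ H) PH.
have [phiC /computes_splitting[rC [iC [sC [splC _]]]]] := dchoice (computes_homology C).
have [phiD /computes_splitting[rD [iD [sD [splD _]]]]] := dchoice (computes_homology D).
have kun := kunneth_computes splC splD.
pose TR := tens_res hG PG PH.
pose E := pr_gtensor (trivQ (G * H)%type) TR.
have [tC tCP] := dchoice (fun p => coinvariants_exists (PG p)).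
have [tD tDP] := dchoice (fun p => coinvariants_exists (PH p)).
pose pi p q : {linear tens_dm (PG p) (PH q) -> tens_obj C D p q} :=
  tmap2 (coinv (PG p)) (coinv (PH q)).
pose t p q : {linear tens_obj C D p q -> tens_dm (PG p) (PH q)} :=
  tmap2 (tC p) (tD q).
have ptP m := coinvariants_tot m (fun p q => coinvariants_tens (tCP p) (tDP q)).
have piact m g x : tot_map pi m (dm_act (tot_dm _ m) g x) = tot_map pi m x.
  by case: (ptP m).
pose T m := tot_dm (fun p q => tens_dm (PG p) (PH q)) m.
(* [kap] and [lam] identify the coinvariants of the tensor resolution with the tensor product of the
   two complexes of coinvariants. *)
pose kap m : {linear E m -> tens_cpx C D m} := coinv_lift (piact m.+1).
pose lam m : {linear tens_cpx C D m -> E m} :=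
  coinv (T m.+1) \o (tot_map t m.+1 : {linear _ -> T m.+1}).
have kapE m x : kap m (coinv _ x) = tot_map pi m.+1 x by exact: coinv_liftE.
have kaplam m x : kap m (lam m x) = x.
  by rewrite [LHS]kapE; case: (ptP m.+1).
have lamkap m x : lam m (kap m x) = x.
  apply: (coinv_ext (f := lam m \o kap m) (g := idfun)) => y.
  have [_ _ h] := ptP m.+1.
  exact (etrans (congr1 (lam m) (kapE m y)) (h y)).
have kapd m x : kap m (cpx_d E m x) = cpx_d (tens_cpx C D) m (kap m.+1 x).
  apply: (coinv_ext (f := kap m \o cpx_d E m)
    (g := cpx_d (tens_cpx C D) m \o kap m.+1)) => y.
  apply: etrans (congr1 (kap m) (gtmap_tens _ _ _)) _.
  apply: etrans (kapE _ _) _; apply: etrans _ (congr1 (cpx_d _ m) (esym (kapE _ _))).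
  apply: tot_map_d => p q z; apply: tmap2_comm => u.
  - exact/esym/gtmap_tens.
  - by [].
  - by [].
  - exact: etrans (linearZ_LR (coinv (PH q)) _ _)
      (congr1 (GRing.scale ((-1) ^+ p)) (esym (gtmap_tens _ _ _))).
(* The sections in [lam] were chosen degree by degree; compatibility with the differentials is
   inherited from the inverse [kap]. *)
have lamd m x : lam m (cpx_d (tens_cpx C D) m x) = cpx_d E m (lam m.+1 x).
  by rewrite -[x in LHS]kaplam -kapd lamkap.
have Ecomp : computes (C := E) (kunneth_proj rC rD n \o kap n).
  apply: (computes_transport kapd lamd) (kun n) => x _; exists 0.
    by rewrite kaplam linear0 subrr.
  by rewrite lamkap linear0 subrr.
(* Passage from the tensor resolution to the given one. *)
have [psi psiP] := computes_resolution (P := TR) PGH Ecomp.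
have [k k_bij] := computes_bijective psiP.
have [f f_bij] := tot_dsum (fun p q => tensor (dH PG p (trivQ G)) (dH PH q (trivQ H))) n.
apply: bijective_pair_trivial k_bij f_bij _.
by apply: dsum_trivial => p z; exact: Tor1_trivial.
Qed.
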